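(* There is a universal constant $C$ such that the following holds for every integer $n\ge2$. Write $N=n^2$. Suppose that $\mathcal{X}$ and $\mathcal{Y}$ are two (independent) sets of $N$ i.i.d. uniformly random points from $\mathbf{S}^2_N$, and $\mathcal{A}$ and $\mathcal{B}$ are two (independent) sets of $n$ i.i.d. uniformly random points from $[0,\sqrt n]^2$. Then $$\frac1n\,\mathbf{E}\min_{\substack{\varphi:\mathcal{A}\to\mathcal{B}\\ \text{bijective}}}\ \sum_{a\in\mathcal{A}}|\varphi(a)-a|\ \le\ C+\frac{C}{N}\cdot\mathbf{E}\min_{\substack{\varphi:\mathcal{X}\to\mathcal{Y}\\ \text{bijective}}}\ \sum_{x\in\mathcal{X}}|\varphi(x)-x|.$$
   Context: For a positive integer $N$, $\mathbf{S}^2_N\subset\mathbf{R}^3$ is the sphere centered at the origin with surface area $N$ (radius $\sqrt{N/(4\pi)}$). $|\cdot|$ is the Euclidean norm (in $\mathbf{R}^2$ or $\mathbf{R}^3$). *)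

(* Defs.v *)
From HB Require Import structures.
From mathcomp Require Import all_boot all_order all_algebra fingroup perm.
From mathcomp Require Import all_classical all_reals all_analysis.

Set Implicit Arguments.
Unset Strict Implicit.
Unset Printing Implicit Defensive.

Import Order.TTheory GRing.Theory Num.Theory.
Import numFieldNormedType.Exports.

Local Open Scope classical_set_scope.
Local Open Scope ring_scope.

(* The norms the library puts on R * R and R * R * R are sup norms, hence the
   explicit Euclidean ones. *)
Definition norm2 (R : realType) (v : R * R) : R :=
  Num.sqrt (v.1 ^+ 2 + v.2 ^+ 2).

Definition norm3 (R : realType) (v : R * R * R) : R :=
  Num.sqrt (v.1.1 ^+ 2 + v.1.2 ^+ 2 + v.2 ^+ 2).

(* [lebesgue_measure] lives on [measurableTypeR R], which is R with the same
   Borel sets as the canonical structure of R, at another display; the type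
   ascription moves to the canonical one. *)
Definition lebesgue2 (R : realType) : set (R * R) -> \bar R :=
  (lebesgue_measure \x lebesgue_measure)%E.

Definition square (R : realType) (l : R) : set (R * R) :=
  `[0, l] `*` `[0, l].

Definition sphere (R : realType) (r : R) : set (R * R * R) :=
  [set p | norm3 p = r].

Definition spherical (R : realType) (r : R) (t : R * R) : R * R * R :=
  (r * sin t.1 * cos t.2, r * sin t.1 * sin t.2, r * cos t.1).

(* Surface area of the part of [sphere r] lying in E.  The area element of the
   parametrization Phi = spherical r, of colatitude t.1 and longitude t.2, is
   |d_1 Phi x d_2 Phi| = r ^ 2 sin t.1. *)
Definition sphere_area (R : realType) (r : R) (E : set (R * R * R)) : \bar R :=
  (\int[(@lebesgue_measure R \x @lebesgue_measure R)%E]_(t in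
      (`[0%R, pi%R] `*` `[0%R, (2 * pi)%R]) `&` spherical r @^-1` E)
    (r ^+ 2 * sin t.1)%:E)%E.

Definition uniform_on (R : realType) (d d' : measure_display)
    (T : measurableType d) (V : measurableType d') (P : probability T R)
    (mu : set V -> \bar R) (S : set V) (X : {RV P >-> V}) : Prop :=
  forall E : set V, measurable E ->
    (distribution P X E = mu (E `&` S) / mu S)%E.

Definition mutually_independent (R : realType) (d d' : measure_display)
    (T : measurableType d) (V : measurableType d') (P : probability T R)
    (I : finType) (X : I -> {RV P >-> V}) : Prop :=
  forall (J : {set I}) (E : I -> set V), (forall i, measurable (E i)) ->
    P (\bigcap_(i in [set` J]) (X i @^-1` E i)) =
    (\prod_(i in J) P (X i @^-1` E i))%E.

Definition iid_uniform (R : realType) (d d' : measure_display)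
    (T : measurableType d) (V : measurableType d') (P : probability T R)
    (mu : set V -> \bar R) (S : set V) (I : finType) (X : I -> {RV P >-> V}) :
    Prop :=
  mutually_independent X /\ forall i, uniform_on mu S (X i).

Definition join_families (I J : Type) (U : Type) (X : I -> U) (Y : J -> U)
    (k : I + J) : U :=
  match k with inl i => X i | inr j => Y j end.

(* Bijections between the point sets {a i} and {b i} are encoded as permutations
   of the indices.  The value at the identity permutation serves as the initial
   value of the iterated minimum and does not affect it. *)
Definition min_matching (R : realType) (V : zmodType) (nrm : V -> R) (n : nat)
    (a b : 'I_n -> V) : R :=
  let cost (s : 'S_n) := \sum_(i < n) nrm (b (s i) - a i) in
  \big[Num.min/cost 1%g]_(s : 'S_n) cost s.

(* Main.v *)
(* Discretize the square into [m * m] cells of side [h] between 1 and 2, with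
   [m * h = sqrt n]; this changes the normalized cost by a constant.  A Lipschitz
   chart maps the uniform law of the sphere, near a square of side of order [n],
   to a multiple of Lebesgue measure, and for each translate [t] of an [m * m]
   patch of the [h]-grid of that square send the points of the sphere outside the
   patch to a cemetery at distance [m] from the patch.  The number of points in a
   patch is binomial with mean [n] and standard deviation at most [sqrt n], so up
   to an error [2 * m * sqrt n] the mean cost of matching [n] uniform cells is at
   most the mean cost of matching the [N] points of the patch-plus-cemetery space.
   Conversely, an optimal matching on the sphere induces one on each of these
   spaces, and an edge of grid length [D] costs at most [5 * m ^ 2 * D] in total
   over all translates: it lies in at most [m ^ 2] patches and crosses the boundary
   of at most [4 * m * D] of them, at cost [m] each.  Average over the order of
   [n ^ 2] translates. *)
Require Import Defs.
From HB Require Import structures.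
From mathcomp Require Import all_boot all_order all_algebra fingroup perm.
From mathcomp Require Import zify ring lra.
From mathcomp Require Import all_classical all_reals all_analysis.
From mathcomp Require Import measurable_realfun.

Set Implicit Arguments.
Unset Strict Implicit.
Unset Printing Implicit Defensive.

Import Order.TTheory GRing.Theory Num.Theory.
Import numFieldNormedType.Exports.

Local Open Scope classical_set_scope.
Local Open Scope ring_scope.

(** * Optimal assignments *)

(** The two random problems live on unrelated probability spaces and no coupling is built: each is
    compared with a finite sum [pexp] that depends only on cell probabilities, and the inequality
    passes through these numbers. The obstacle is that a patch contains a random number of points,
    in general different for the two families, so restricting a matching to it gives no bijection;
    with the cemetery all [N] points stay in play. Its distance [m] fits twice. Cells of a patch are
    at distance at most [2 * m], which yields the triangle inequality; and a perimeter of order [m]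
    times a crossing cost [m] has the same order [m ^ 2] as the number of translates containing a
    given point. With [K] of order [n] and [m ^ 2 <= n], averaging over [K ^ 2] translates leaves a
    factor of order [1 / n], which the normalization by [n] turns into [1 / N]. All rounding errors,
    and the deviation [2 * m * sqrt n], contribute order [n] to the planar cost and end up in the
    constant. *)

Definition assign (R : realType) (n : nat) (w : 'I_n -> 'I_n -> R) : R :=
  let cost (s : 'S_n) := \sum_(i < n) w i (s i) in
  \big[Num.min/cost 1%g]_(s : 'S_n) cost s.

Lemma min_matchingE (R : realType) (V : zmodType) (nrm : V -> R) (n : nat)
    (a b : 'I_n -> V) :
  min_matching nrm a b = assign (fun i j => nrm (b j - a i)).
Proof. by []. Qed.

Lemma assign_le (R : realType) (n : nat) (w : 'I_n -> 'I_n -> R) (s : 'S_n) :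
  assign w <= \sum_(i < n) w i (s i).
Proof. exact: bigmin_le. Qed.

Lemma le_assign (R : realType) (n : nat) (w : 'I_n -> 'I_n -> R) (x : R) :
  (forall s : 'S_n, x <= \sum_(i < n) w i (s i)) -> x <= assign w.
Proof. by move=> h; apply: le_bigmin => // s _; apply: h. Qed.

Lemma assign_ge0 (R : realType) (n : nat) (w : 'I_n -> 'I_n -> R) :
  (forall i j, 0 <= w i j) -> 0 <= assign w.
Proof. by move=> w0; apply: le_assign => s; apply: sumr_ge0. Qed.

(** Every permutation uses exactly [n] entries, so an error [b] per entry costs [b * n] whichever
    matching is optimal. All roundings of points to cells enter through this bound. *)
Lemma assign_affine (R : realType) (n : nat) (w w' : 'I_n -> 'I_n -> R)
    (a b : R) : 0 <= a ->
  (forall i j, w i j <= a * w' i j + b) -> assign w <= a * assign w' + b * n%:R.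
Proof.
move=> a0 ww'.
have [a_eq0|a_neq0] := eqVneq a 0.
  rewrite a_eq0 mul0r add0r (le_trans (assign_le w 1%g))//.
  apply: (@le_trans _ _ (\sum_(i < n) b)).
    by apply: ler_sum => i _; rewrite (le_trans (ww' _ _))// a_eq0 mul0r add0r.
  by rewrite sumr_const card_ord mulr_natr.
have a_gt0 : 0 < a by rewrite lt_def a_neq0.
rewrite -lerBlDr -ler_pdivrMl//; apply: le_assign => s.
rewrite ler_pdivrMl// lerBlDr (le_trans (assign_le w s))//.
rewrite mulr_sumr mulr_natr -[n in b *+ n]card_ord -sumr_const -big_split/=.
by apply: ler_sum => i _.
Qed.

Definition matchc (R : realType) (U : Type) (c : U -> U -> R) (n : nat)
    (x y : 'I_n -> U) : R := assign (fun i j => c (x i) (y j)).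

Lemma matchc_ext (R : realType) (U : Type) (c : U -> U -> R) (n : nat)
    (x x' y y' : 'I_n -> U) : x =1 x' -> y =1 y' ->
  matchc c x y = matchc c x' y'.
Proof. by move=> /funext -> /funext ->. Qed.

Lemma matchc_permr (R : realType) (U : Type) (c : U -> U -> R) (n : nat)
    (x y : 'I_n -> U) (p : 'S_n) :
  matchc c x y <= matchc c x (y \o p).
Proof.
rewrite /matchc; apply: le_assign => s; apply: (le_trans (assign_le _ (s * p)%g)).
by under eq_bigr do rewrite permM.
Qed.

Lemma matchc_sym (R : realType) (U : Type) (c : U -> U -> R) (n : nat)
    (x y : 'I_n -> U) : (forall u v, c u v = c v u) ->
  matchc c x y = matchc c y x.
Proof.
move=> cC.
suff le (a b : 'I_n -> U) : matchc c a b <= matchc c b a by apply/le_anti; rewrite !le.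
rewrite /matchc; apply: le_assign => s; apply: (le_trans (assign_le _ s^-1%g)).
rewrite (reindex_inj (@perm_inj _ s))/=.
by under eq_bigr do rewrite permK cC.
Qed.

Lemma matchc_tri (R : realType) (U : Type) (c : U -> U -> R) (n : nat)
    (x x' y : 'I_n -> U) : (forall u v w, c u w <= c u v + c v w) ->
  matchc c x y <= matchc c x' y + \sum_(i < n) c (x i) (x' i).
Proof.
move=> tri; rewrite -lerBlDr /matchc; apply: le_assign => s; rewrite lerBlDr.
rewrite (le_trans (assign_le _ s))// -big_split/=.
by apply: ler_sum => i _; rewrite addrC tri.
Qed.

(* Points of [Q] together with a cemetery [None] at distance [M] from all of
   them. *)
Definition ocost (R : realType) (Q : Type) (d : Q -> Q -> R) (M : R)
    (u v : option Q) : R :=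
  match u, v with
  | Some p, Some q => d p q
  | None, None => 0
  | _, _ => M
  end.

(** A configuration of exactly [n] points, viewed in the [N]-point space with cemetery so that it
    can be compared with one where the number of points is random. *)
Definition opad (Q : Type) (N n : nat) (a : 'I_N -> Q) (i : 'I_N) : option Q :=
  if (i < n)%N then Some (a i) else None.

(* A common cemetery point [j] of both families can be matched with itself: the
   triangle inequality through [None] lets us short-cut the two edges at [j]. *)
Lemma assign_fix (R : realType) (Q : Type) (c : option Q -> option Q -> R)
    (n N : nat) (x y : 'I_N -> option Q) (s : 'S_N) :
  c None None = 0 -> (forall u v w, c u w <= c u v + c v w) ->
  (forall i : 'I_N, (n <= i)%N -> x i = None /\ y i = None) ->
  forall m, (n + m <= N)%N ->
  exists2 s' : 'S_N, (forall i : 'I_N, (N - m <= i)%N -> s' i = i) &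
    \sum_(i < N) c (x i) (y (s' i)) <= \sum_(i < N) c (x i) (y (s i)).
Proof.
move=> c0 tri xy; elim=> [_|m IH nm].
  by exists s => // i; rewrite subn0 leqNgt ltn_ord.
have [|s1 s1fix s1le] := IH; first by lia.
have kN : (N - m.+1 < N)%N by lia.
pose j := Ordinal kN.
have [xj yj] : x j = None /\ y j = None by apply: xy => /=; lia.
(* Permutations compose from left to right: the new one fixes [j] and sends the former preimage [i0]
   of [j] to [s1 j], which is the short-cut. *)
exists (s1 * tperm (s1 j) j)%g.
  move=> i ki; rewrite permM.
  have [->|ij] := eqVneq i j; first by rewrite tpermL.
  have ki' : (N - m <= i)%N.
    by move: ij; rewrite -val_eqE/=; lia.
  rewrite (s1fix i ki') tpermD//; last by rewrite eq_sym.
  by apply: contra ij => /eqP e; apply/eqP/(@perm_inj _ s1); rewrite -e s1fix// e.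
apply: le_trans s1le.
have [e|sj] := eqVneq (s1 j) j.
  by rewrite e tperm1 mulg1.
pose i0 := (s1^-1)%g j.
have s1i0 : s1 i0 = j by rewrite /i0 permKV.
have i0j : i0 != j by apply: contraNneq sj => e; rewrite -[X in s1 X]e s1i0.
rewrite (bigD1 j)//= [leRHS](bigD1 j)//= (bigD1 i0)//= [X in _ <= _ + X](bigD1 i0)//=.
rewrite !permM tpermL s1i0 tpermR xj yj c0 add0r addrA.
apply: lerD; first by rewrite addrC tri.
apply: ler_sum => i /andP[ij ii0]; rewrite permM tpermD//.
  by apply: contra ij => /eqP/perm_inj ->.
by apply: contra ii0 => /eqP e; apply/eqP/(@perm_inj _ s1); rewrite s1i0.
Qed.

Lemma perm_restrict (n N : nat) (nN : (n <= N)%N) (s : 'S_N) :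
  (forall i : 'I_N, (n <= i)%N -> s i = i) ->
  exists s' : 'S_n, forall i, widen_ord nN (s' i) = s (widen_ord nN i).
Proof.
move=> sfix.
have slt (i : 'I_n) : (s (widen_ord nN i) < n)%N.
  rewrite ltnNge; apply/negP => h.
  have /perm_inj/(congr1 val)/= e := sfix _ h.
  by move: h; rewrite e leqNgt ltn_ord.
pose f i := Ordinal (slt i).
have finj : injective f.
  by move=> i j /(congr1 val)/= /val_inj/perm_inj/(congr1 val)/= /val_inj.
by exists (perm finj) => i; apply: val_inj; rewrite /= permE.
Qed.

(** Once every padding index is matched with itself, the padding costs 0 and the rest of the
    permutation acts on the first [n] indices. *)
Lemma matchc_unpad (R : realType) (Q : Type) (d : Q -> Q -> R) (M : R)
    (n N : nat) (nN : (n <= N)%N) (a b : 'I_N -> Q) :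
  (forall u v w, ocost d M u w <= ocost d M u v + ocost d M v w) ->
  matchc d (a \o widen_ord nN) (b \o widen_ord nN) <=
  matchc (ocost d M) (opad n a) (opad n b).
Proof.
move=> tri; rewrite /matchc; apply: le_assign => s.
have xy (i : 'I_N) : (n <= i)%N -> opad n a i = None /\ opad n b i = None.
  by move=> ni; rewrite /opad ltnNge ni.
have [|s1 s1fix s1le] := @assign_fix R Q (ocost d M) n N (opad n a) (opad n b) s
   erefl tri xy (N - n); first by lia.
rewrite subKn// in s1fix.
apply: le_trans s1le.
have [s2 s2E] := perm_restrict nN s1fix.
apply: (le_trans (assign_le _ s2)).
rewrite [leRHS](bigID (fun i : 'I_N => (i < n)%N))/= [X in _ <= _ + X]big1 ?addr0.
  rewrite (big_ord_narrow nN) le_eqVlt; apply/orP; left; apply/eqP.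
  apply: eq_bigr => i _; rewrite /= -s2E /opad/= !ltn_ord.
  by rewrite /= -?s2E.
move=> i; rewrite -leqNgt => ni; rewrite s1fix//.
by have [-> ->] := xy _ ni.
Qed.

(** * Expectations under finite product laws *)

(* [mu] is not required to have total mass 1. *)
Definition pexp (R : realType) (I U : finType) (mu : U -> R)
    (F : {ffun I -> U} -> R) : R :=
  \sum_(x : {ffun I -> U}) (\prod_i mu (x i)) * F x.

Lemma pexp_prod (R : realType) (I U : finType) (mu : U -> R)
    (g : I -> U -> R) :
  pexp mu (fun x => \prod_i g i (x i)) = \prod_i \sum_u mu u * g i u.
Proof. by rewrite bigA_distr_bigA; apply: eq_bigr => x _; rewrite big_split. Qed.

Lemma pexp_le (R : realType) (I U : finType) (mu : U -> R)
    (F G : {ffun I -> U} -> R) : (forall u, 0 <= mu u) ->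
  (forall x, F x <= G x) -> pexp mu F <= pexp mu G.
Proof.
move=> mu0 FG; apply: ler_sum => x _; rewrite ler_wpM2l//.
by apply: prodr_ge0 => i _.
Qed.

Lemma eq_pexp (R : realType) (I U : finType) (mu : U -> R)
    (F G : {ffun I -> U} -> R) : F =1 G -> pexp mu F = pexp mu G.
Proof. by move=> FG; apply: eq_bigr => x _; rewrite FG. Qed.

Lemma pexpD (R : realType) (I U : finType) (mu : U -> R)
    (F G : {ffun I -> U} -> R) :
  pexp mu (fun x => F x + G x) = pexp mu F + pexp mu G.
Proof. by rewrite -big_split; apply: eq_bigr => x _; rewrite mulrDr. Qed.

Lemma pexpZ (R : realType) (I U : finType) (mu : U -> R) (a : R)
    (F : {ffun I -> U} -> R) :
  pexp mu (fun x => a * F x) = a * pexp mu F.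
Proof. by rewrite mulr_sumr; apply: eq_bigr => x _; rewrite mulrCA. Qed.

Lemma pexp_sum (R : realType) (I U J : finType) (mu : U -> R)
    (F : J -> {ffun I -> U} -> R) :
  pexp mu (fun x => \sum_j F j x) = \sum_j pexp mu (F j).
Proof.
by rewrite exchange_big; apply: eq_bigr => x _; rewrite mulr_sumr.
Qed.

Lemma pexp_cst (R : realType) (I U : finType) (mu : U -> R) (a : R) :
  \sum_u mu u = 1 -> pexp mu (fun _ : {ffun I -> U} => a) = a.
Proof.
move=> mu1; rewrite /pexp -mulr_suml.
have := @bigA_distr_bigA R 0 1 *%R +%R I U (fun _ => mu) => <-.
by rewrite big1 ?mul1r.
Qed.

Lemma pexp_exchange (R : realType) (I J U V : finType) (mu : U -> R)
    (nu : V -> R) (F : {ffun I -> U} -> {ffun J -> V} -> R) :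
  pexp mu (fun x => pexp nu (F x)) = pexp nu (fun y => pexp mu (F^~ y)).
Proof.
rewrite /pexp; under eq_bigr do rewrite mulr_sumr.
rewrite exchange_big; apply: eq_bigr => y _; rewrite mulr_sumr.
by apply: eq_bigr => x _; rewrite mulrCA.
Qed.

Lemma pexp_map (R : realType) (I U V : finType) (mu : U -> R) (nu : V -> R)
    (h : U -> V) (F : {ffun I -> V} -> R) :
  (forall v, nu v = \sum_(u | h u == v) mu u) ->
  pexp mu (fun x => F [ffun i => h (x i)]) = pexp nu F.
Proof.
move=> nuE.
rewrite /pexp (partition_big (fun x : {ffun I -> U} => [ffun i => h (x i)])
  xpredT)//=.
apply: eq_bigr => y _.
under eq_bigr => x /eqP -> do [].
rewrite -mulr_suml; congr (_ * _).
under [RHS]eq_bigr do rewrite nuE.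
have /= -> := @bigA_distr_big_dep R 0 1 *%R +%R I U (fun i u => h u == y i) (fun=> mu).
apply: eq_bigl => x.
apply/eqP/familyP => [<- i|xy]; first by rewrite unfold_in ffunE.
by apply/ffunP => i; rewrite ffunE; have := xy i; rewrite unfold_in => /eqP.
Qed.

Lemma pexp_pair (R : realType) (I U V : finType) (mu : U -> R) (nu : V -> R)
    (F : {ffun I -> U * V} -> R) :
  pexp (fun p => mu p.1 * nu p.2) F =
  pexp mu (fun x => pexp nu (fun y => F [ffun i => (x i, y i)])).
Proof.
rewrite /pexp; under [RHS]eq_bigr do rewrite mulr_sumr.
rewrite pair_bigA/=.
pose h (p : {ffun I -> U} * {ffun I -> V}) : {ffun I -> U * V} :=
  [ffun i => (p.1 i, p.2 i)].
rewrite (reindex h)/=; last first.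
  exists (fun z => ([ffun i => (z i).1], [ffun i => (z i).2])) => [[x y] _|z _].
    by congr pair; apply/ffunP => i; rewrite !ffunE.
  by apply/ffunP => i; rewrite !ffunE/= -surjective_pairing.
apply: eq_bigr => -[x y] _; rewrite mulrA -big_split/=.
by congr (_ * _); apply: eq_bigr => i _; rewrite ffunE.
Qed.

Lemma pexp_sumtype (R : realType) (I J U : finType) (mu : U -> R)
    (F : {ffun I + J -> U} -> R) :
  pexp mu F = pexp mu (fun x => pexp mu (fun y =>
    F [ffun k => match k with inl i => x i | inr j => y j end])).
Proof.
rewrite /pexp; under [RHS]eq_bigr do rewrite mulr_sumr.
rewrite pair_bigA/=.
pose h (p : {ffun I -> U} * {ffun J -> U}) : {ffun I + J -> U} :=
  [ffun k => match k with inl i => p.1 i | inr j => p.2 j end].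
rewrite (reindex h)/=; last first.
  exists (fun z => ([ffun i => z (inl i)], [ffun i => z (inr i)])) => [[x y] _|z _].
    by congr pair; apply/ffunP => i; rewrite !ffunE.
  by apply/ffunP => -[] i; rewrite !ffunE.
apply: eq_bigr => -[x y] _; rewrite mulrA big_sumType/=.
by congr (_ * _ * _); apply: eq_bigr => i _; rewrite ffunE.
Qed.

Lemma pexp_perm (R : realType) (I U : finType) (mu : U -> R)
    (p : {perm I}) (F : {ffun I -> U} -> R) :
  pexp mu (fun x => F [ffun i => x (p i)]) = pexp mu F.
Proof.
rewrite /pexp [RHS](reindex (fun x : {ffun I -> U} => [ffun i => x (p i)]))/=.
  apply: eq_bigr => x _; congr (_ * _).
  by rewrite (reindex_inj (@perm_inj _ p)); apply: eq_bigr => i _; rewrite ffunE.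
exists (fun x : {ffun I -> U} => [ffun i => x ((p^-1)%g i)]) => x _;
  by apply/ffunP => i; rewrite !ffunE ?permK ?permKV.
Qed.

Lemma pexp_restrict (R : realType) (I J U : finType) (mu : U -> R)
    (f : I -> J) (F : {ffun I -> U} -> R) :
  injective f -> \sum_u mu u = 1 ->
  pexp mu (fun x => F [ffun i => x (f i)]) = pexp mu F.
Proof.
move=> finj mu1.
(* Expanding [F] over its values reduces the claim to indicators of points, which are products.
   Grouping the factors by their image under [f] leaves an empty product, hence total mass 1, at
   each index outside the image. *)
transitivity (\sum_(a : {ffun I -> U}) F a *
    pexp mu (fun x : {ffun J -> U} => \prod_i (x (f i) == a i)%:R)).
  rewrite -[RHS]/(\sum_a _); under [RHS]eq_bigr do rewrite -pexpZ.
  rewrite -pexp_sum; apply: eq_pexp => x.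
  rewrite (bigD1 [ffun i => x (f i)])//= big1 ?mulr1 => [|i _]; last first.
    by rewrite ffunE eqxx.
  rewrite big1 ?addr0// => a /eqP ax.
  have /existsP[i xa] : [exists i, x (f i) != a i].
    apply/existsPn => xa; apply: ax; apply/ffunP => i; rewrite ffunE.
    by have /negPn/eqP -> := xa i.
  by rewrite (bigD1 i)//= (negbTE xa) mul0r mulr0.
apply: eq_bigr => a _; rewrite mulrC; congr (_ * _).
under eq_pexp do rewrite (partition_big f xpredT)//=.
transitivity (pexp mu (fun x : {ffun J -> U} =>
    \prod_j \prod_(i | f i == j) (x j == a i)%:R)).
  apply: eq_pexp => x; apply: eq_bigr => j _.
  by apply: eq_bigr => i /eqP ->.
rewrite (pexp_prod mu (fun j u => \prod_(i | f i == j) (u == a i)%:R)).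
rewrite [RHS](partition_big f xpredT)//=; apply: eq_bigr => j _.
have [/existsP[i /eqP fi]|/existsPn fj] := boolP [exists i, f i == j].
  have fij k : (f k == j) = (k == i) by rewrite -fi (inj_eq finj).
  under eq_bigr do rewrite (eq_bigl _ _ fij) big_pred1_eq.
  rewrite (eq_bigl _ _ fij) big_pred1_eq (bigD1 (a i))//= eqxx mulr1.
  by rewrite big1 ?addr0// => u /negbTE ->; rewrite mulr0.
under eq_bigr do rewrite (eq_bigl _ _ (fun i => negbTE (fj i))) big_pred0_eq mulr1.
by rewrite (eq_bigl _ _ (fun i => negbTE (fj i))) big_pred0_eq.
Qed.

(** The variance of a sum of independent centered variables: the cross terms factor by [pexp_prod]
    and one of their factors is the vanishing mean of [g]. *)
Lemma pexp_sum_centered_sqr (R : realType) (I U : finType) (mu : U -> R)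
    (g : U -> R) : \sum_u mu u = 1 -> \sum_u mu u * g u = 0 ->
  pexp mu (fun x : {ffun I -> U} => (\sum_i g (x i)) ^+ 2) =
  #|I|%:R * \sum_u mu u * g u ^+ 2.
Proof.
move=> mu1 g0.
under eq_pexp do rewrite expr2 big_distrlr/=.
rewrite pexp_sum -sum1_card natr_sum mulr_suml; apply: eq_bigr => i _.
rewrite mul1r pexp_sum (bigD1 i)//= [X in _ + X]big1 ?addr0 => [|j ji].
  transitivity (pexp mu (fun x : {ffun I -> U} =>
      \prod_k (if k == i then g (x k) ^+ 2 else 1))).
    apply: eq_pexp => x; rewrite (bigD1 i)//= eqxx big1 ?mulr1 ?expr2//.
    by move=> k /negbTE ->.
  rewrite (pexp_prod mu (fun k u => if k == i then g u ^+ 2 else 1)).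
  rewrite (bigD1 i)//= eqxx [X in _ * X]big1 ?mulr1// => k /negbTE ->.
  by under eq_bigr do rewrite mulr1.
transitivity (pexp mu (fun x : {ffun I -> U} =>
    \prod_k (if k == i then g (x k) else if k == j then g (x k) else 1))).
  apply: eq_pexp => x; rewrite (bigD1 i)//= eqxx (bigD1 j)//= (negbTE ji) eqxx.
  by rewrite big1 ?mulr1// => k /andP[/negbTE -> /negbTE ->].
rewrite (pexp_prod mu
  (fun k u => if k == i then g u else if k == j then g u else 1)).
by rewrite (bigD1 i)//= eqxx g0 mul0r.
Qed.

(** Boolean vectors with equally many entries [true] are permutations of each other, in particular
    [b] and the indicator of an initial segment. *)
Lemma perm_sort_bool (N : nat) (b : 'I_N -> bool) :
  exists p : 'S_N, forall i : 'I_N, b (p i) = (i < \sum_(j < N) b j)%N.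
Proof.
set k := (\sum_(j < N) b j)%N.
have kN : (k <= N)%N.
  by rewrite -[leqRHS]card_ord -sum1_card leq_sum// => i _; case: (b i).
pose t := [tuple b i | i < N].
pose u := [tuple (i < k)%N | i < N].
have uE : val u = nseq k true ++ nseq (N - k) false.
  rewrite /u /= -[RHS](mkseq_nth false) size_cat !size_nseq subnKC//.
  rewrite /mkseq -val_enum_ord -map_comp; apply: eq_map => i /=.
  rewrite nth_cat size_nseq; case: ltnP => ik; first by rewrite nth_nseq ik.
  by rewrite nth_nseq if_same.
have tk : count_mem true t = k.
  rewrite -sum1_count big_map big_mkcond/= /k big_enum/=.
  by apply: eq_bigr => i _; case: (b i).
have perm_ut : perm_eq u t.
  have cnt (s : seq bool) : count_mem false s = (size s - count_mem true s)%N.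
    rewrite -(count_predC (pred1 true) s) addKn.
    by apply: eq_count => -[].
  apply/seq.permP => a.
  have split (s : seq bool) : count a s =
      (a true * count_mem true s + a false * count_mem false s)%N.
    by elim: s => [|[] s IH] /=; rewrite ?muln0// IH /=;
      case: (a true); case: (a false); rewrite /= ?mul1n ?mul0n; lia.
  by rewrite !split !cnt !size_tuple tk uE count_cat !count_nseq/= mul1n mul0n addn0.
have /tuple_permP[p pE] := perm_ut.
exists p => i.
have /(congr1 (fun v => tnth v i)) : u = [tuple tnth t (p i) | i < N].
  exact: val_inj.
by rewrite !tnth_mktuple => ->.
Qed.

(** The right-hand side is |k - n| in truncated subtraction. The induction is on the upper summation
    limit, with both thresholds cut off at it. *)
Lemma sum_ltn_neq (N k n : nat) : (k <= N)%N -> (n <= N)%N ->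
  (\sum_(i < N) ((i < k) != (i < n)) = (k - n) + (n - k))%N.
Proof.
move=> kN nN.
suff h m : (\sum_(i < m) ((i < k) != (i < n)) =
    (minn k m - minn n m) + (minn n m - minn k m))%N.
  by rewrite h (minn_idPl kN) (minn_idPl nN).
elim: m => [|m IH]; first by rewrite big_ord0 !minn0.
rewrite big_ord_recr/= IH.
by case: (ltnP m k); case: (ltnP m n) => /=; lia.
Qed.

(** * Uniform cells versus cells with a cemetery *)

Definition umass (R : realType) (Q : finType) (q : Q) : R := #|Q|%:R^-1.

(** The law of the position in a patch of a uniform point of the sphere: [p] is the share of the
    patch in the total area. *)
Definition omass (R : realType) (Q : finType) (p : R) (u : option Q) : R :=
  if u is Some _ then p / #|Q|%:R else 1 - p.

Lemma sum_umass (R : realType) (Q : finType) : (0 < #|Q|)%N ->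
  \sum_(q : Q) umass R q = 1.
Proof.
by move=> Q0; rewrite /umass sumr_const -[LHS]mulr_natr mulVf// pnatr_eq0 -lt0n.
Qed.

(* Under [omass p] the number of points outside the cemetery is binomial with mean
   [n].  Conditionally on it these points are uniform, and a permutation brings
   them to the front, so that the two sides differ by [M] times the deviation of
   the binomial variable from its mean. *)
Lemma pexp_opad_le (R : realType) (Q : finType) (d : Q -> Q -> R) (M p s : R)
    (n N : nat) (F : {ffun 'I_N -> option Q} -> R) :
  (0 < #|Q|)%N -> (n <= N)%N -> 0 <= p <= 1 -> N%:R * p = n%:R ->
  0 < s -> s ^+ 2 = n%:R -> 0 <= M -> (forall q, d q q = 0) ->
  (forall (x : {ffun 'I_N -> option Q}) (t : 'S_N), F [ffun i => x (t i)] = F x) ->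
  (forall x y : {ffun 'I_N -> option Q}, F x <= F y + \sum_i ocost d M (x i) (y i)) ->
  pexp (@umass R Q) (fun a => F [ffun i => opad n a i]) <=
  pexp (@omass R Q p) F + M * s.
Proof.
move=> Q0 nN /andP[p0 p1] Np s0 s2 M0 d0 Fsym Flip.
pose mask (z : bool * Q) := if z.1 then Some z.2 else None.
pose bern (b : bool) : R := if b then p else 1 - p.
have bern0 b : 0 <= bern b by case: b; rewrite //= subr_ge0.
have bern1 : \sum_b bern b = 1 by rewrite big_bool/= addrC subrK.
have umass0 (q : Q) : 0 <= umass R q by rewrite invr_ge0.
(* Under [omass p] a point is a uniform cell masked by an independent Bernoulli variable, so the set
   of unmasked indices can be fixed before the cells are drawn. *)
have -> : pexp (@omass R Q p) F = pexp bern (fun b => pexp (@umass R Q)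
    (fun a => F [ffun i => mask (b i, a i)])).
  rewrite -(@pexp_map R _ _ _ (fun z => bern z.1 * umass R z.2) (omass p) mask).
    rewrite pexp_pair; apply: eq_pexp => b; apply: eq_pexp => a.
    by congr F; apply/ffunP => i; rewrite !ffunE.
  move=> [q|] /=.
    rewrite (big_pred1 (true, q))//= => -[[] q'] /=; rewrite /mask/=.
      by rewrite xpair_eqE eqxx.
    by rewrite xpair_eqE.
  rewrite big_mkcond -(pair_bigA _ (fun b q => if mask (b, q) == None
    then bern b * umass R q else 0))/= big_bool/= big1_eq add0r.
  by rewrite -mulr_sumr sum_umass// mulr1.
rewrite -[leLHS](@pexp_cst R 'I_N bool bern _ bern1).
(* AM-GM: [|e| <= s / 2 + e ^+ 2 / (2 * s)], and the variance is at most [n]. *)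
have K2 : pexp bern (fun b : {ffun 'I_N -> bool} =>
    (\sum_i ((b i)%:R - p)) ^+ 2) <= n%:R.
  rewrite (@pexp_sum_centered_sqr R 'I_N bool bern (fun b => b%:R - p))//.
    rewrite card_ord big_bool/= -Np ler_wpM2l// sub0r sqrrN.
    by nra.
  by rewrite big_bool/=; ring.
have -> : M * s = M * (s / 2 + (2 * s)^-1 * n%:R).
  by rewrite -s2; field; rewrite gt_eqF.
apply: (@le_trans _ _ (pexp bern (fun b => pexp (@umass R Q)
    (fun a => F [ffun i => mask (b i, a i)]) +
    M * (s / 2 + (2 * s)^-1 * (\sum_i ((b i)%:R - p)) ^+ 2)))); last first.
  rewrite pexpD lerD2l pexpZ ler_wpM2l// pexpD pexp_cst// lerD2l pexpZ.
  by rewrite ler_wpM2l// invr_ge0 mulr_ge0// ltW.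
apply: pexp_le => // b.
have [t tE] := perm_sort_bool b.
set k := (\sum_(j < N) b j)%N in tE.
have kN : (k <= N)%N.
  by rewrite -[leqRHS]card_ord -sum1_card leq_sum// => i _; case: (b i).
have -> : \sum_i ((b i)%:R - p) = k%:R - n%:R :> R.
  by rewrite sumrB sumr_const card_ord -[p *+ N]mulr_natl Np /k natr_sum.
(* Both [F] and the product law of [a] are invariant under permutations, so the unmasked indices may
   be taken to be the first [k]. *)
have -> : pexp (@umass R Q) (fun a => F [ffun i => mask (b i, a i)]) =
    pexp (@umass R Q) (fun a => F [ffun i : 'I_N => mask ((i < k)%N, a i)]).
  rewrite -[RHS](pexp_perm _ t); apply: eq_pexp => a; rewrite -[LHS](Fsym _ t).
  by congr F; apply/ffunP => i; rewrite !ffunE tE.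
rewrite -[X in _ <= _ + X](@pexp_cst R 'I_N Q (@umass R Q)) ?sum_umass//.
rewrite -pexpD; apply: pexp_le => // a.
apply: (le_trans (Flip _ [ffun i : 'I_N => mask ((i < k)%N, a i)])).
rewrite lerD2l.
apply: (@le_trans _ _ (\sum_(i < N) M * ((i < k)%N != (i < n)%N)%:R)).
  apply: ler_sum => i _; rewrite !ffunE /opad /mask/=.
  by case: (i < n)%N; case: (i < k)%N; rewrite /= ?d0 ?mulr0 ?mulr1.
rewrite -mulr_sumr ler_wpM2l// -natr_sum sum_ltn_neq//.
set e : R := k%:R - n%:R.
have -> : ((k - n) + (n - k))%:R = `|e| :> R.
  rewrite /e; case: (leqP k n) => kn.
    by rewrite (eqP kn) add0n distrC natrB// ger0_norm// subr_ge0 ler_nat.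
  have /eqP -> : (n - k == 0)%N by rewrite subn_eq0 ltnW.
  by rewrite addn0 natrB 1?ltnW// ger0_norm// subr_ge0 ler_nat ltnW.
rewrite -[e ^+ 2]real_normK ?num_real//.
rewrite -subr_ge0.
have -> : s / 2 + (2 * s)^-1 * `|e| ^+ 2 - `|e| = (`|e| - s) ^+ 2 / (2 * s).
  by field; rewrite gt_eqF.
by rewrite divr_ge0 ?sqr_ge0// mulr_ge0// ltW.
Qed.

Lemma sum_omass (R : realType) (Q : finType) (p : R) : (0 < #|Q|)%N ->
  \sum_(u : option Q) omass p u = 1.
Proof.
move=> Q0; rewrite (bigD1 None)//= (reindex_omap Some id) => [|[]//].
rewrite (eq_bigl xpredT) => [|q]; last by rewrite eqxx.
rewrite sumr_const -[_ *+ #|_|]mulr_natr mulfVK ?subrK//.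
by rewrite pnatr_eq0 -lt0n.
Qed.

Lemma ocost_sym (R : realType) (Q : Type) (d : Q -> Q -> R) (M : R) :
  (forall p q, d p q = d q p) -> forall u v, ocost d M u v = ocost d M v u.
Proof. by move=> dC [p|] [q|] /=. Qed.

Lemma ocost_ge0 (R : realType) (Q : Type) (d : Q -> Q -> R) (M : R) :
  0 <= M -> (forall p q, 0 <= d p q) -> forall u v, 0 <= ocost d M u v.
Proof. by move=> M0 d0 [p|] [q|] /=. Qed.

(** A detour through the cemetery costs [2 * M], which must not undercut the direct distance: this
    is the role of the bound on the diameter. *)
Lemma ocost_tri (R : realType) (Q : Type) (d : Q -> Q -> R) (M : R) :
  0 <= M -> (forall p q, 0 <= d p q <= 2 * M) ->
  (forall p q r, d p r <= d p q + d q r) ->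
  forall u v w, ocost d M u w <= ocost d M u v + ocost d M v w.
Proof.
move=> M0 dM tri [p|] [q|] [r|] //=; rewrite ?addr0 ?add0r//.
- by have := dM p q; lra.
- by have := dM p r; lra.
- by have := dM q r; lra.
- lra.
Qed.

Lemma pexp_matchc_le (R : realType) (Q : finType) (d : Q -> Q -> R)
    (M p s : R) (n N : nat) :
  (0 < #|Q|)%N -> (n <= N)%N -> 0 <= p <= 1 -> N%:R * p = n%:R ->
  0 < s -> s ^+ 2 = n%:R -> 0 <= M ->
  (forall q, d q q = 0) -> (forall q q', d q q' = d q' q) ->
  (forall q q', 0 <= d q q' <= 2 * M) ->
  (forall q q' q'', d q q'' <= d q q' + d q' q'') ->
  pexp (@umass R Q) (fun a : {ffun 'I_n -> Q} =>
    pexp (@umass R Q) (fun b : {ffun 'I_n -> Q} => matchc d a b)) <=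
  pexp (@omass R Q p) (fun x : {ffun 'I_N -> option Q} =>
    pexp (@omass R Q p) (fun y : {ffun 'I_N -> option Q} =>
      matchc (ocost d M) x y)) + 2 * (M * s).
Proof.
move=> Q0 nN p01 Np s0 s2 M0 d0 dC dM tri.
have otri := ocost_tri M0 dM tri.
have oC := @ocost_sym R Q d M dC.
have /andP[p0 p1] := p01.
have widen_inj : injective (widen_ord nN).
  by move=> i j /(congr1 val)/= /val_inj.
have umass0 (q : Q) : 0 <= umass R q by rewrite invr_ge0.
have omass0 (u : option Q) : 0 <= omass p u.
  by case: u => [q|] /=; rewrite ?divr_ge0// subr_ge0.
have umass1 := sum_umass R Q0.
have Vsyml (x : {ffun 'I_N -> option Q}) (y : 'I_N -> option Q) (t : 'S_N) :
    matchc (ocost d M) [ffun i => x (t i)] y = matchc (ocost d M) x y.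
  rewrite !(matchc_sym _ y oC); apply/le_anti/andP; split.
    rewrite (le_trans (matchc_permr _ _ _ t^-1%g))//.
    by rewrite (@matchc_ext _ _ _ _ y y _ x)// => i; rewrite /= ffunE permKV.
  rewrite (le_trans (matchc_permr _ _ _ t))//.
  by rewrite (@matchc_ext _ _ _ _ y y _ [ffun i => x (t i)])// => i; rewrite /= ffunE.
(* The [n]-point families become the first [n] coordinates of [N]-point families, the form in which
   [opad] applies. *)
rewrite -(@pexp_restrict _ _ _ _ _ (widen_ord nN))//.
under eq_pexp do rewrite -(@pexp_restrict _ _ _ _ _ (widen_ord nN))//.
apply: (@le_trans _ _ (pexp (@umass R Q) (fun a : {ffun 'I_N -> Q} =>
    pexp (@umass R Q) (fun b : {ffun 'I_N -> Q} =>
      matchc (ocost d M) [ffun i => opad n a i] [ffun i => opad n b i])))).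
  apply: pexp_le => // a; apply: pexp_le => // b.
  rewrite (@matchc_ext _ _ d _ _ (a \o widen_ord nN) _ (b \o widen_ord nN));
    [|by move=> i; rewrite ffunE..].
  rewrite (@matchc_ext _ _ (ocost d M) _ _ (opad n a) _ (opad n b));
    [|by move=> i; rewrite ffunE..].
  exact: matchc_unpad.
(* The two families are randomized one at a time, each at cost [M * s]; in between, the two
   expectations are exchanged so that the family still to be replaced is innermost. *)
apply: (@le_trans _ _ (pexp (@umass R Q) (fun a : {ffun 'I_N -> Q} =>
    pexp (@omass R Q p) (fun y : {ffun 'I_N -> option Q} =>
      matchc (ocost d M) [ffun i => opad n a i] y)) + M * s)).
  rewrite -[X in _ <= _ + X](@pexp_cst R 'I_N Q (@umass R Q))// -pexpD.
  apply: pexp_le => // a.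
  apply: (@pexp_opad_le _ _ d M p s n N
    (fun y => matchc (ocost d M) [ffun i => opad n a i] y)) => //.
    by move=> x t; rewrite !(matchc_sym [ffun i => opad n a i] _ oC) Vsyml.
  move=> x y; rewrite !(matchc_sym [ffun i => opad n a i] _ oC).
  exact: matchc_tri.
rewrite mulr2n mulrDl mul1r addrA lerD2r pexp_exchange [in leRHS]pexp_exchange.
rewrite -[X in _ <= _ + X](@pexp_cst R 'I_N (option Q) (@omass R Q p)).
  rewrite -pexpD; apply: pexp_le => // y.
  apply: (@pexp_opad_le _ _ d M p s n N (fun x => matchc (ocost d M) x y)) => //.
    by move=> x x'; exact: matchc_tri.
exact: sum_omass.
Qed.

(** * Patches of the integer grid *)

(** The thresholds [t] that separate [x] from [y] are counted by [|g K x - g K y|], where [g k z] is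
    the number of [t < k] with [t <= z]; this is 1-Lipschitz in [z]. *)
Lemma sum_ord_ltz_neq (K : nat) (x y : int) :
  (\sum_(t < K) ((x < t%:Z)%R != (y < t%:Z)%R) <= `|x - y|)%N.
Proof.
pose g (k : nat) (z : int) : int :=
  if z < 0 then 0 else if z < k%:Z then z + 1 else k%:Z.
suff -> : (\sum_(t < K) ((x < t%:Z)%R != (y < t%:Z)%R) = `|g K x - g K y|)%N.
  by rewrite /g; do 4 ?[case: ifP => ?]; lia.
elim: K => [|K IH]; first by rewrite big_ord0 /g; do 4 ?[case: ifP => ?]; lia.
rewrite big_ord_recr/= IH /g.
case: (ltP x K%:Z); case: (ltP y K%:Z) => //= ? ?;
  do 6 ?[case: ifP => ?]; lia.
Qed.

Definition in_win (m t : nat) (x : int) : bool :=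
  (t%:Z <= x) && (x < t%:Z + m%:Z).

(** A window separates two points only if one of its two ends does, whence the factor 2. *)
Lemma sum_in_win_neq (R : realType) (K m : nat) (x y : int) :
  \sum_(t < K) (in_win m t x != in_win m t y)%:R <= 2 * `|x - y|%:~R :> R.
Proof.
rewrite -natr_sum -abszE -pmulrn -natrM ler_nat mul2n -addnn.
apply: (@leq_trans (\sum_(t < K) ((x < t%:Z)%R != (y < t%:Z)%R) +
    \sum_(t < K) ((x - m%:Z < t%:Z)%R != (y - m%:Z < t%:Z)%R))).
  rewrite -big_split/=; apply: leq_sum => t _; rewrite /in_win.
  do 2 ![case: leP => ?]; do 4 ![case: ltP => ?] => //=; lia.
apply: leq_add; first exact: sum_ord_ltz_neq.
apply: (leq_trans (sum_ord_ltz_neq _ _ _)); lia.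
Qed.

(** The window at [t] contains [x] exactly when [x - m < t <= x], that is, when [t] separates [x]
    from [x - m]. *)
Lemma sum_in_win (R : realType) (K m : nat) (x : int) :
  \sum_(t < K) (in_win m t x)%:R <= m%:R :> R.
Proof.
rewrite -natr_sum ler_nat.
apply: (@leq_trans (\sum_(t < K) ((x < t%:Z)%R != (x - m%:Z < t%:Z)%R))).
  apply: leq_sum => t _; rewrite /in_win.
  case: leP => ?; do 2 ![case: ltP => ?] => //=; lia.
apply: (leq_trans (sum_ord_ltz_neq _ _ _)); lia.
Qed.

(** The test [t <= x] is needed because the absolute value would fold integers below [t] back into
    the window. *)
Definition wcell (m t : nat) (x : int) : option 'I_m :=
  if t%:Z <= x then insub `|x - t%:Z|%N else None.

Lemma wcell_eq_some (m t : nat) (x : int) (i : 'I_m) :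
  (wcell m t x == Some i) = (x == t%:Z + (i : nat)%:Z).
Proof.
rewrite /wcell; case: ifPn => [tx|tx]; last first.
  by apply/esym/negbTE; apply: contra tx => /eqP ->; lia.
case: insubP => [j jm jx|jm].
  apply/eqP/eqP => [[<-]|xi]; first by rewrite jx; lia.
  by congr Some; apply: val_inj; rewrite /= jx; lia.
by apply/esym/negbTE; apply: contra jm => /eqP ->; have := ltn_ord i; lia.
Qed.

Lemma wcell_isSome (m t : nat) (x : int) : wcell m t x = in_win m t x :> bool.
Proof.
rewrite /wcell /in_win; case: ifPn => //= tx.
case: insubP => [j jm jx|jm] /=; lia.
Qed.

(* The position of [u] inside the [m x m] patch of lower left corner [t]. *)
Definition patch (m : nat) (t : nat * nat) (u : int * int) :
    option ('I_m * 'I_m) :=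
  match wcell m t.1 u.1, wcell m t.2 u.2 with
  | Some i, Some j => Some (i, j)
  | _, _ => None
  end.

(** The l1 distance: boundary crossings are counted in each coordinate separately and add up to
    it. *)
Definition zdist (R : realType) (u v : int * int) : R :=
  (`|u.1 - v.1| + `|u.2 - v.2|)%:~R.

Definition zcell (m : nat) (q : 'I_m * 'I_m) : int * int :=
  ((q.1 : nat)%:Z, (q.2 : nat)%:Z).

Definition qdist (R : realType) (m : nat) (q q' : 'I_m * 'I_m) : R :=
  zdist R (zcell q) (zcell q').

Lemma patch_eq_some (m : nat) (t : nat * nat) (u : int * int) (q : 'I_m * 'I_m) :
  (patch m t u == Some q) =
  (u == (t.1%:Z + (q.1 : nat)%:Z, t.2%:Z + (q.2 : nat)%:Z)).
Proof.
case: u q => u1 u2 [i j]; rewrite xpair_eqE/= -!wcell_eq_some /patch/=.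
by case: wcell => [i'|]; case: wcell => [j'|] //=; rewrite andbF.
Qed.

Lemma qdist_patch (R : realType) (m : nat) (t : nat * nat)
    (u v : int * int) (q q' : 'I_m * 'I_m) :
  patch m t u = Some q -> patch m t v = Some q' -> qdist R q q' = zdist R u v.
Proof.
move=> /eqP + /eqP; rewrite !patch_eq_some => /eqP -> /eqP ->.
by rewrite /qdist /zdist/=; congr (_ %:~R); lia.
Qed.

(** An edge with exactly one end in the patch leaves it through some coordinate, while in the other
    coordinate its inner end is in the window. Each term is a product of a factor in [t.1] and one
    in [t.2], so that the double sum over translates factorizes. *)
Lemma ocost_patch_le (R : realType) (m : nat) (t : nat * nat) (u v : int * int) :
  ocost (@qdist R m) m%:R (patch m t u) (patch m t v) <=
  (in_win m t.1 u.1)%:R * (in_win m t.2 u.2)%:R * zdist R u v +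
  m%:R * ((in_win m t.1 u.1 != in_win m t.1 v.1)%:R *
           ((in_win m t.2 u.2)%:R + (in_win m t.2 v.2)%:R)) +
  m%:R * (((in_win m t.1 u.1)%:R + (in_win m t.1 v.1)%:R) *
           (in_win m t.2 u.2 != in_win m t.2 v.2)%:R).
Proof.
have D0 : 0 <= zdist R u v by rewrite ler0z; lia.
have m0 : 0 <= m%:R :> R by [].
have := @qdist_patch R m t u v.
rewrite -!wcell_isSome /patch.
case: (wcell _ _ u.1) => [i|]; case: (wcell _ _ u.2) => [j|];
  case: (wcell _ _ v.1) => [i'|]; case: (wcell _ _ v.2) => [j'|] //= h;
  rewrite ?(h _ _ erefl erefl)//; nra.
Qed.

Lemma sum_ocost_patch (R : realType) (K m : nat) (u v : int * int) :
  \sum_(t : 'I_K * 'I_K) ocost (@qdist R m) m%:R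
    (patch m (t.1 : nat, t.2 : nat) u) (patch m (t.1 : nat, t.2 : nat) v) <=
  5 * m%:R ^+ 2 * zdist R u v.
Proof.
apply: (le_trans (ler_sum _ (fun t _ => ocost_patch_le _ _ _ _ _))) => /=.
rewrite !big_split/= -mulr_suml -!mulr_sumr.
pose a1 (t : nat) : R := (in_win m t u.1)%:R.
pose a2 (t : nat) : R := (in_win m t u.2)%:R.
pose b1 (t : nat) : R := (in_win m t v.1)%:R.
pose b2 (t : nat) : R := (in_win m t v.2)%:R.
pose e1 (t : nat) : R := (in_win m t u.1 != in_win m t v.1)%:R.
pose e2 (t : nat) : R := (in_win m t u.2 != in_win m t v.2)%:R.
rewrite -(pair_bigA _ (fun i j : 'I_K => a1 i * a2 j))/=.
rewrite -(pair_bigA _ (fun i j : 'I_K => e1 i * (a2 j + b2 j)))/=.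
rewrite -(pair_bigA _ (fun i j : 'I_K => (a1 i + b1 i) * e2 j))/=.
rewrite -!big_distrlr/= !big_split/=.
have /= A1 := sum_in_win R K m u.1; have /= A2 := sum_in_win R K m u.2.
have /= B1 := sum_in_win R K m v.1; have /= B2 := sum_in_win R K m v.2.
have /= E1 := sum_in_win_neq R K m u.1 v.1.
have /= E2 := sum_in_win_neq R K m u.2 v.2.
set x1 : R := `|u.1 - v.1|%:~R in E1; set x2 : R := `|u.2 - v.2|%:~R in E2.
have -> : zdist R u v = x1 + x2 by rewrite /zdist intrD.
have ge0 (f : nat -> bool) : 0 <= \sum_(t < K) (f t)%:R :> R by exact: sumr_ge0.
have A10 : 0 <= \sum_(t < K) a1 t by exact: (ge0 (fun t => in_win m t u.1)).
have A20 : 0 <= \sum_(t < K) a2 t by exact: (ge0 (fun t => in_win m t u.2)).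
have B10 : 0 <= \sum_(t < K) b1 t by exact: (ge0 (fun t => in_win m t v.1)).
have B20 : 0 <= \sum_(t < K) b2 t by exact: (ge0 (fun t => in_win m t v.2)).
have E10 : 0 <= \sum_(t < K) e1 t.
  exact: (ge0 (fun t => in_win m t u.1 != in_win m t v.1)).
have E20 : 0 <= \sum_(t < K) e2 t.
  exact: (ge0 (fun t => in_win m t u.2 != in_win m t v.2)).
have M0 : 0 <= m%:R :> R by [].
have x10 : 0 <= x1 by rewrite ler0z.
have x20 : 0 <= x2 by rewrite ler0z.
have -> : 5 * m%:R ^+ 2 * (x1 + x2) = m%:R * m%:R * (x1 + x2) +
    m%:R * (2 * x1 * (m%:R + m%:R)) + m%:R * ((m%:R + m%:R) * (2 * x2)) :> R.
  by ring.
apply: lerD; [apply: lerD|].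
- by rewrite ler_wpM2r ?addr_ge0// ler_pM.
- by rewrite ler_wpM2l// ler_pM ?addr_ge0 ?lerD.
- by rewrite ler_wpM2l// ler_pM ?addr_ge0 ?lerD.
Qed.

Lemma qdistxx (R : realType) (m : nat) (q : 'I_m * 'I_m) : qdist R q q = 0.
Proof. by rewrite /qdist /zdist !subrr. Qed.

Lemma zdist_sym (R : realType) (u v : int * int) : zdist R u v = zdist R v u.
Proof. by rewrite /zdist distrC [`|u.2 - _|]distrC. Qed.

Lemma zdist_ge0 (R : realType) (u v : int * int) : 0 <= zdist R u v.
Proof. by rewrite ler0z addr_ge0. Qed.

Lemma zdist_tri (R : realType) (u v w : int * int) :
  zdist R u w <= zdist R u v + zdist R v w.
Proof. by rewrite /zdist -intrD ler_int; lia. Qed.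

Lemma qdist_le (R : realType) (m : nat) (q q' : 'I_m * 'I_m) :
  0 <= qdist R q q' <= 2 * m%:R.
Proof.
rewrite zdist_ge0/= /qdist /zdist -natrM [_%:R]pmulrn ler_int.
have := ltn_ord q.1; have := ltn_ord q.2; have := ltn_ord q'.1.
by have := ltn_ord q'.2; rewrite /zcell/=; lia.
Qed.

Lemma sum_matchc_patch (R : realType) (N K m : nat) (u v : 'I_N -> int * int) :
  \sum_(t : 'I_K * 'I_K) matchc (ocost (@qdist R m) m%:R)
    (fun i => patch m (t.1 : nat, t.2 : nat) (u i))
    (fun i => patch m (t.1 : nat, t.2 : nat) (v i)) <=
  5 * m%:R ^+ 2 * matchc (@zdist R) u v.
Proof.
have [m0|m0] := eqVneq m 0.
  have noneE t x : patch m t x = None.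
    rewrite /patch; case: (wcell m t.1 x.1) => // i.
    by exfalso; have := ltn_ord i; rewrite [ltnRHS]m0.
  rewrite [X in 5 * X%:R ^+ 2]m0 expr0n/= mulr0 mul0r.
  apply: sumr_le0 => t _; rewrite (le_trans (assign_le _ 1%g))// big1// => i _.
  by rewrite !noneE.
have c0 : 0 < 5 * m%:R ^+ 2 :> R.
  by rewrite mulr_gt0// exprn_gt0// ltr0n lt0n.
rewrite -ler_pdivrMl//; rewrite /matchc; apply: le_assign => s.
rewrite ler_pdivrMl// mulr_sumr.
apply: (@le_trans _ _ (\sum_(t : 'I_K * 'I_K) \sum_(i < N)
    ocost (@qdist R m) m%:R (patch m (t.1 : nat, t.2 : nat) (u i))
      (patch m (t.1 : nat, t.2 : nat) (v (s i))))).
  by apply: ler_sum => t _; exact: assign_le.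
by rewrite exchange_big; apply: ler_sum => i _; exact: sum_ocost_patch.
Qed.

(** * Laws of finitely valued functions of iid families *)

Lemma measurable_ffun_preimage (R : realType) (d d' : measure_display)
    (T : measurableType d) (V : measurableType d') (P : probability T R)
    (I U : finType) (Z : I -> {RV P >-> V}) (h : V -> U) (x : {ffun I -> U}) :
  (forall u, measurable (h @^-1` [set u])) ->
  measurable ((fun w => [ffun i => h (Z i w)]) @^-1` [set x]).
Proof.
move=> mh; rewrite (_ : _ @^-1` _ =
    \bigcap_(i in [set: I]) (Z i @^-1` (h @^-1` [set x i]))).
  apply: fin_bigcap_measurable => // i _.
  by rewrite -[X in measurable X]setTI; exact: measurable_funP.
apply/seteqP; split => w /=; first by move=> <- i _ /=; rewrite ffunE.
by move=> wx; apply/ffunP => i; rewrite ffunE; exact: wx.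
Qed.

(** The integrand is a simple function, constant on the atoms [A x], and independence makes the
    probability of an atom a product. This is the only passage from random points to finite sums. *)
Lemma iid_expectation (R : realType) (d d' : measure_display)
    (T : measurableType d) (V : measurableType d') (P : probability T R)
    (I U : finType) (Z : I -> {RV P >-> V}) (h : V -> U) (mu : U -> R)
    (F : {ffun I -> U} -> R) :
  (forall u, measurable (h @^-1` [set u])) -> mutually_independent Z ->
  (forall i u, P (Z i @^-1` (h @^-1` [set u])) = (mu u)%:E) ->
  (forall x, 0 <= F x) ->
  ('E_P[fun w => F [ffun i => h (Z i w)]] = (pexp mu F)%:E)%E.
Proof.
move=> mh indep law F0.
pose A (x : {ffun I -> U}) : set T :=
  \bigcap_(i in [set` (finset.setTfor I)]) (Z i @^-1` (h @^-1` [set x i])).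
have mA x : measurable (A x).
  apply: fin_bigcap_measurable => // i _.
  by rewrite -[X in measurable X]setTI; exact: measurable_funP.
have PA x : P (A x) = (\prod_i mu (x i))%:E.
  rewrite (indep _ (fun i => h @^-1` [set x i]))//.
  rewrite -prodEFin; apply: eq_big => [i|i _]; first by rewrite finset.in_setT.
  exact: law.
rewrite unlock.
transitivity (\int[P]_w \sum_(x : {ffun I -> U}) ((F x)%:E * (\1_(A x) w)%:E))%E.
  apply: eq_integral => w _; set z := [ffun i => h (Z i w)].
  rewrite (bigD1 z)//= big1 ?adde0 => [|x xz].
    rewrite indicE mem_set ?mule1// => i _ /=.
    by rewrite /z ffunE.
  rewrite indicE memNset ?mule0// => Ax; move/eqP: xz; apply.
  by apply/ffunP => i; rewrite /z ffunE; apply/esym/(Ax i) => /=; rewrite finset.in_setT.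
rewrite ge0_integral_sum//; last 2 first.
- move=> x; apply: emeasurable_funM => //.
  by apply/measurable_EFinP; exact: measurable_indic.
- by move=> x w _; rewrite mule_ge0// lee_fin.
rewrite /pexp -sumEFin; apply: eq_bigr => x _.
rewrite ge0_integralZl ?lee_fin//.
  by rewrite integral_indic// setIT [X in (_ * X)%E]PA -EFinM mulrC.
by apply/measurable_EFinP; exact: measurable_indic.
Qed.

(** * The chart of the sphere *)

Lemma integral_prod_fst (R : realType) (A B : set R) (f : R -> R) :
  measurable A -> measurable B -> measurable_fun setT f ->
  (forall x, A x -> 0 <= f x) ->
  (\int[(@lebesgue_measure R \x @lebesgue_measure R)%E]_(t in A `*` B)
     (f t.1)%:E =
   (\int[lebesgue_measure]_(x in A) (f x)%:E) * lebesgue_measure B)%E.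
Proof.
move=> mA mB mf f0.
have mg : measurable_fun setT (f \_ A).
  by apply/(measurable_restrictT _ _).1 => //; exact: measurable_funTS.
have g0 x : 0 <= (f \_ A) x.
  by rewrite patchE; case: ifPn => // /set_mem; exact: f0.
have mB1 : measurable_fun setT (fun y => (\1_B y)%:E : \bar R).
  by apply/measurable_EFinP; exact: measurable_indic.
rewrite integral_mkcond [in RHS]integral_mkcond.
have -> : (fun t : measurableTypeR R * measurableTypeR R => (f t.1)%:E) \_ (A `*` B) =
    fun t => (((f \_ A) t.1)%:E * (\1_B t.2)%:E)%E.
  apply/funext => -[x y] /=; rewrite !patchE indicE.
  have [/set_mem[/= Ax By]|/negP nAB] := boolP ((x, y) \in A `*` B).
    by rewrite !mem_set// mule1.
  have [/set_mem Ax|_] := boolP (x \in A); last by rewrite mul0e.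
  rewrite memNset ?mule0// => By; apply: nAB; exact: mem_set.
rewrite fubini_tonelli1/=; last 2 first.
- apply: emeasurable_funM; last exact: measurableT_comp mB1 _.
  by apply/measurable_EFinP; exact: measurableT_comp mg _.
- by move=> t; rewrite mule_ge0// lee_fin.
transitivity (\int[lebesgue_measure]_x (((f \_ A) x)%:E * lebesgue_measure B))%E.
  apply: eq_integral => x _; rewrite /fubini_F/= ge0_integralZl ?lee_fin//.
  by rewrite integral_indic// setIT.
rewrite ge0_integralZr//; last 2 first.
- by apply/measurable_EFinP.
- by move=> x _; rewrite lee_fin.
congr (_ * _)%E; apply: eq_integral => x _; rewrite !patchE.
by case: ifP.
Qed.

Lemma integral_sin (R : realType) (a b : R) : a < b ->
  (\int[lebesgue_measure]_(x in `[a, b]) (sin x)%:E = (cos a - cos b)%:E)%E.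
Proof.
move=> ab.
have dF (x : R) : is_derive x (1 : R) (- (@cos R)) (sin x).
  by rewrite -[sin x]opprK; exact: is_deriveN.
have cF (x : R) : (- (@cos R)) y @[y --> x] --> (- (@cos R)) x.
  by apply: cvgN; exact: continuous_cos.
rewrite (@continuous_FTC2 _ _ (- (@cos R)))//.
- by rewrite -EFinB opprK addrC.
- by apply: continuous_subspaceT => x; exact: continuous_sin.
- split => //.
  + exact/cvg_at_right_filter/cF.
  + exact/cvg_at_left_filter/cF.
- by move=> x _; rewrite derive1E derive_val.
Qed.

(** Archimedes' theorem on spherical zones: the area depends only on the height [d - c]. As cosine
    decreases on [[0, pi]], the band is the interval []acos (d / r), acos (c / r)]], empty when
    [c = d]. *)
Lemma integral_sin_band (R : realType) (r c d : R) : 0 < r ->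
  - r <= c -> c <= d -> d <= r ->
  let A := [set x | 0 <= x <= pi /\ c <= r * cos x < d] in
  measurable A /\
  (\int[lebesgue_measure]_(x in A) (sin x)%:E = ((d - c) / r)%:E)%E.
Proof.
move=> r0 rc cd dr A.
have [c_lt_d|] := ltP c d; last first.
  move=> dc; have -> : A = set0.
    apply/seteqP; split => // x [_ /andP[cx xd]].
    by move: (le_lt_trans cx xd); rewrite ltNge dc.
  split; first exact: measurable0.
  rewrite integral_set0 (_ : d - c = 0) ?mul0r//.
  by apply/eqP; rewrite subr_eq0 eq_le cd dc.
have dr1 : -1 <= d / r <= 1.
  by rewrite ler_pdivlMr// ler_pdivrMr// mulN1r mul1r dr (le_trans rc).
have cr1 : -1 <= c / r <= 1.
  by rewrite ler_pdivlMr// ler_pdivrMr// mulN1r mul1r rc (le_trans cd).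
have acosI y : -1 <= y <= 1 -> acos y \in `[0, pi].
  by move=> y1; rewrite in_itv/= acos_ge0// acos_lepi.
have dE x : x \in `[0, pi] -> (acos (d / r) < x) = (r * cos x < d).
  move=> x0; rewrite -[LHS]ltr_cos ?acosI// acosK ?in_itv//.
  by rewrite ltr_pdivlMr// mulrC.
have cE x : x \in `[0, pi] -> (x <= acos (c / r)) = (c <= r * cos x).
  move=> x0; rewrite leNgt -ltr_cos ?acosI// acosK ?in_itv// -leNgt.
  by rewrite ler_pdivrMr// mulrC.
have AE : A = `]acos (d / r), acos (c / r)]%classic.
  apply/seteqP; split => x /=; rewrite in_itv/=.
    by move=> [x0pi /andP[cx xd]]; rewrite dE ?cE ?in_itv//= xd.
  move=> /andP[dx xc].
  have x0pi : 0 <= x <= pi.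
    by rewrite (le_trans xc) ?acos_lepi// (le_trans _ (ltW dx)) ?acos_ge0.
  by split => //; rewrite -dE ?in_itv// -cE ?in_itv// xc.
rewrite AE; split; first exact: measurable_itv.
have lt_acos : acos (d / r) < acos (c / r).
  by rewrite -ltr_cos ?acosI// !acosK ?in_itv// ltr_pM2r ?invr_gt0.
rewrite integral_itv_obnd_cbnd ?integral_sin//.
  by rewrite !acosK ?in_itv// -mulrBl.
apply/measurable_EFinP; apply: measurable_funTS.
by apply: continuous_measurable_fun; exact: continuous_sin.
Qed.

(* Taking [`|p.1.2|] folds the sphere onto a half-sphere, so that no cut in the
   longitude is needed; the factor 2 in the first coordinate compensates the
   resulting multiplicity.  For points at distance at most [r / 2] from the plane
   [y = 0] the first coordinate is not the longitude, but such points are not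
   mapped into the square [`[0, r / 2[ ^ 2]]. *)
Definition chart (R : realType) (r : R) (p : R * R * R) : R * R :=
  (2 * r * atan (p.1.1 / Num.max `|p.1.2| (r / 2)), p.2).

(** Here [s] is the longitude counted from the plane [x = 0]. If [st * cos s >= 1 / 2], the quotient
    is [tan s] and the arctangent returns [s]. *)
Lemma atan_fold (R : realType) (r st ct s a b : R) : 0 < r -> 0 <= st ->
  0 <= ct <= 1 / 2 -> ct ^+ 2 + st ^+ 2 = 1 -> - (pi / 2) <= s <= pi / 2 ->
  0 <= a -> b <= r / 2 ->
  (a <= 2 * r * atan (r * st * sin s / Num.max (r * st * cos s) (r / 2)) < b) =
  (a <= 2 * r * s < b).
Proof.
move=> r0 st0 /andP[ct0 ct12] sc sI a0 br.
have coss0 : 0 <= cos s by exact: cos_ge0_pihalf.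
have pi2 : 2 <= pi :> R := pi_ge2 R.
have cs := cos2Dsin2 s.
have [h|h] := leP (1 / 2) (st * cos s).
  have u0 : r / 2 <= r * st * cos s by nra.
  have cosgt0 : 0 < cos s.
    by rewrite lt_def coss0 andbT; apply/eqP => e; move: h; rewrite e mulr0; lra.
  have sI' : s \in `](- (pi / 2)), (pi / 2)[.
    move: sI; rewrite in_itv/= !le_eqVlt => /andP[/orP[/eqP e|->]].
      by exfalso; move: cosgt0; rewrite -e cosN cos_pihalf ltxx.
    move=> /orP[/eqP e|->//].
    by exfalso; move: cosgt0; rewrite e cos_pihalf ltxx.
  have stgt0 : 0 < st.
    by rewrite lt_def st0 andbT; apply/eqP => e; move: h; rewrite e mul0r; lra.
  rewrite (max_idPl u0) (_ : _ / _ = tan s) ?tanK//.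
  by rewrite /tan; field; rewrite !gt_eqF.
have u0 : r * st * cos s <= r / 2 by nra.
rewrite (max_idPr u0) (_ : _ / _ = 2 * (st * sin s)); last first.
  by field; rewrite gt_eqF.
have st34 : 3 / 4 <= st ^+ 2 by nra.
(* Now [st * cos s < 1 / 2], and neither side can hold: the left one would give
   [st * sin s < 1 / 2], hence [st ^+ 2 < 1 / 2]; the right one makes [s] small, so that
   [cos s ^+ 2 > 1 / 2] and [st * cos s > 1 / 2]. Both contradict [st ^+ 2 >= 3 / 4]. *)
transitivity false.
  apply/negbTE/negP => /andP[av vb].
  have w0 : 0 <= 2 * (st * sin s).
    rewrite leNgt; apply/negP => /lt_atan; rewrite atan0 => at0; nra.
  have w1 : 2 * (st * sin s) < 1.
    rewrite ltNge; apply/negP => /le_atan; rewrite atan1 => at1; nra.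
  have : st ^+ 2 = (st * sin s) ^+ 2 + (st * cos s) ^+ 2.
    by rewrite !exprMn -mulrDr addrC cs mulr1.
  have : 0 <= st * cos s by exact: mulr_ge0.
  nra.
apply/esym/negbTE/negP => /andP[av vb].
have s0 : 0 <= s by nra.
have s1 : s < 1 / 2 by nra.
have : 0 < cos (s *+ 2) by apply: cos_gt0_pihalf; lra.
rewrite cos_mulr2n => c2.
have : (st * cos s) ^+ 2 > 1 / 4 by rewrite exprMn; nra.
have : 0 <= st * cos s by exact: mulr_ge0.
nra.
Qed.

Lemma lebesgue_measure_bnd (R : realType) (b0 b1 : bool) (a b : R) : a <= b ->
  lebesgue_measure [set` Interval (BSide b0 a) (BSide b1 b)] = (b - a)%:E.
Proof.
move=> ab; rewrite lebesgue_measure_itv/= lte_fin.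
case: ltP => // ba; rewrite (_ : b - a = 0)//.
by apply/eqP; rewrite subr_eq0 eq_le ab ba.
Qed.

(** The chart is a folded Lambert cylindrical equal-area projection. The two sheets have total
    longitude [(b - a) / r], the band contributes [(d - c) / r], and the area element brings
    [r ^ 2]. *)
Lemma sphere_area_chart (R : realType) (r a b c d : R) : 0 < r ->
  0 <= a -> a <= b -> b <= r / 2 -> 0 <= c -> c <= d -> d <= r / 2 ->
  sphere_area r [set p | a <= (chart r p).1 < b /\ c <= (chart r p).2 < d] =
  ((b - a) * (d - c))%:E.
Proof.
move=> r0 a0 ab br c0 cd dr.
have [mI iI] := @integral_sin_band R r c d r0 ltac:(lra) cd ltac:(lra).
set I := [set x | _ /\ _] in mI iI.
have pi2 : 2 <= pi :> R := pi_ge2 R.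
(* The longitudes of the two sheets, [y > 0] around [pi / 2] and [y < 0] around [3 * pi / 2]. On the
   first one the coordinate decreases with the longitude, which reverses the half-open interval. *)
pose J1 := `](pi / 2 - b / (2 * r)), (pi / 2 - a / (2 * r))]%classic : set R.
pose J2 := `[(3 * pi / 2 + a / (2 * r)), (3 * pi / 2 + b / (2 * r))[%classic : set R.
have a2r : 0 <= a / (2 * r) by rewrite divr_ge0//; lra.
have b2r : b / (2 * r) <= 1 / 4 by rewrite ler_pdivrMr; lra.
have ab2r : a / (2 * r) <= b / (2 * r) by rewrite ler_pM2r// invr_gt0; lra.
have DE : (`[0%R, pi%R] `*` `[0%R, (2 * pi)%R]) `&` spherical r @^-1`
    [set p | a <= (chart r p).1 < b /\ c <= (chart r p).2 < d] =
    I `*` (J1 `|` J2) :> set (R * R).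
  have foldE t1 s : I t1 -> - (pi / 2) <= s <= pi / 2 ->
    (a <= 2 * r * atan (r * sin t1 * sin s /
       Num.max (r * sin t1 * cos s) (r / 2)) < b) =
    (a / (2 * r) <= s < b / (2 * r)).
    move=> [/= t1pi /andP[ct1 ct2]] sI.
    rewrite (@atan_fold _ r _ (cos t1))//.
    - by rewrite ler_pdivrMr ?ltr_pdivlMr; try lra; rewrite mulrC.
    - exact: sin_ge0_pi.
    - by apply/andP; split; nra.
    - exact: cos2Dsin2.
  have xE1 (t2 : R) : cos t2 = sin (pi / 2 - t2).
    by rewrite sinB cos_pihalf sin_pihalf mul0r subr0 mul1r.
  have yE1 (t2 : R) : sin t2 = cos (pi / 2 - t2).
    by rewrite cosB cos_pihalf sin_pihalf mul0r add0r mul1r.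
  have p32 (t2 : R) : t2 - 3 * pi / 2 = t2 - pi / 2 - pi by lra.
  have xE2 (t2 : R) : cos t2 = sin (t2 - 3 * pi / 2).
    by rewrite p32 sinB sinpi cospi sinBpihalf mulr0 subr0 mulrN1 opprK.
  have yE2 (t2 : R) : - sin t2 = cos (t2 - 3 * pi / 2).
    by rewrite p32 cosB sinpi cospi cosBpihalf mulr0 addr0 mulrN1.
  apply/seteqP; split => -[t1 t2] /=.
    rewrite /I /J1 /J2 /= !in_itv/= => -[[t1I /andP[t20 t22]] [ch cz]].
    have It1 : I t1 by split.
    have rs0 : 0 <= r * sin t1 by rewrite mulr_ge0 ?sin_ge0_pi// ltW.
    split => //.
    have [t2pi|pit2] := leP t2 pi; [left|right].
      have sI : - (pi / 2) <= pi / 2 - t2 <= pi / 2 by lra.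
      move: ch; rewrite [in X in X -> _]ger0_norm; last first.
        by rewrite mulr_ge0// sin_ge0_pi// t20.
      rewrite xE1 [sin t2]yE1 foldE//; lra.
    have sI : - (pi / 2) <= t2 - 3 * pi / 2 <= pi / 2 by lra.
    move: ch; rewrite -normrN -mulrN yE2 ger0_norm; last first.
      by rewrite mulr_ge0// cos_ge0_pihalf.
    rewrite xE2 foldE//; lra.
  rewrite /J1 /J2 /= !in_itv/= => -[It1 J].
  have [t1I cz] := It1.
  have rs0 : 0 <= r * sin t1 by rewrite mulr_ge0 ?sin_ge0_pi// ltW.
  case: J => J; (split; [by split => //; lra|split => //]).
    have sI : - (pi / 2) <= pi / 2 - t2 <= pi / 2 by lra.
    rewrite ger0_norm; last by rewrite mulr_ge0// sin_ge0_pi//; lra.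
    rewrite xE1 [sin t2]yE1 foldE//; lra.
  have sI : - (pi / 2) <= t2 - 3 * pi / 2 <= pi / 2 by lra.
  rewrite -normrN -mulrN yE2 ger0_norm; last first.
    by rewrite mulr_ge0// cos_ge0_pihalf.
  rewrite xE2 foldE//; lra.
rewrite /sphere_area DE.
have mJ : measurable (J1 `|` J2) by apply: measurableU; exact: measurable_itv.
have It0 t1 : I t1 -> 0 <= sin t1 by move=> [t1I _]; exact: sin_ge0_pi.
have mf : measurable_fun setT (fun x : R => r ^+ 2 * sin x).
  apply: measurable_funM => //.
  by apply: continuous_measurable_fun; exact: continuous_sin.
rewrite (@integral_prod_fst R I (J1 `|` J2) (fun x => r ^+ 2 * sin x))//; last first.
  by move=> x Ix; rewrite mulr_ge0 ?sqr_ge0 ?It0.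
under eq_integral do rewrite EFinM.
rewrite ge0_integralZl ?lee_fin ?sqr_ge0//; last first.
  apply/measurable_EFinP; apply: measurable_funTS.
  by apply: continuous_measurable_fun; exact: continuous_sin.
have -> : lebesgue_measure (J1 `|` J2) = ((b - a) / r)%:E.
  have J12 : J1 `&` J2 = set0.
    by apply/seteqP; split => // x; rewrite /J1 /J2 /= !in_itv/=; lra.
  have m1 : lebesgue_measure J1 = (b / (2 * r) - a / (2 * r))%:E.
    by rewrite /J1 lebesgue_measure_bnd; [congr EFin; lra|lra].
  have m2 : lebesgue_measure J2 = (b / (2 * r) - a / (2 * r))%:E.
    by rewrite /J2 lebesgue_measure_bnd; [congr EFin; lra|lra].
  transitivity (lebesgue_measure J1 + lebesgue_measure J2)%E.
    by apply: measureU => //; exact: measurable_itv.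
  by rewrite m1 m2 -EFinD; congr EFin; field; lra.
by rewrite iI -!EFinM; congr EFin; field; lra.
Qed.

Lemma spherical_on_sphere (R : realType) (r : R) (t : R * R) : 0 <= r ->
  sphere r (spherical r t).
Proof.
move=> r0; rewrite /sphere/= /norm3/=.
rewrite (_ : _ + _ = r ^+ 2) ?sqrtr_sqr ?ger0_norm//.
have := cos2Dsin2 t.1; have := cos2Dsin2 t.2 => h2 h1.
transitivity (r ^+ 2 * ((cos t.2 ^+ 2 + sin t.2 ^+ 2) * sin t.1 ^+ 2 + cos t.1 ^+ 2)).
  by ring.
by rewrite h2 mul1r addrC h1 mulr1.
Qed.

Lemma sphere_area_sphere (R : realType) (r : R) : 0 <= r ->
  sphere_area r (sphere r) = (4 * pi * r ^+ 2)%:E.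
Proof.
move=> r0; rewrite /sphere_area.
have pi0 : 0 < pi :> R := pi_gt0 R.
have -> : (`[0%R, pi%R] `*` `[0%R, (2 * pi)%R]) `&` spherical r @^-1` sphere r =
    `[0%R, pi%R] `*` `[0%R, (2 * pi)%R] :> set (R * R).
  by apply/setIidPl => t _; exact: spherical_on_sphere.
have mf : measurable_fun setT (fun x : R => r ^+ 2 * sin x).
  apply: measurable_funM => //.
  by apply: continuous_measurable_fun; exact: continuous_sin.
have It0 (x : R) : `[0, pi]%classic x -> 0 <= sin x.
  by rewrite /= in_itv/=; exact: sin_ge0_pi.
rewrite (@integral_prod_fst R `[0, pi] `[0, 2 * pi]
  (fun x => r ^+ 2 * sin x))//; last first.
  by move=> x Ix; rewrite mulr_ge0 ?sqr_ge0 ?It0.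
under eq_integral do rewrite EFinM.
rewrite ge0_integralZl ?lee_fin ?sqr_ge0//; last first.
  apply/measurable_EFinP; apply: measurable_funTS.
  by apply: continuous_measurable_fun; exact: continuous_sin.
rewrite integral_sin// cospi cos0 lebesgue_measure_bnd; last by lra.
by rewrite -!EFinM; congr EFin; ring.
Qed.

Lemma atan_lipschitz (R : realType) (x y : R) : `|atan x - atan y| <= `|x - y|.
Proof.
wlog xy : x y / y <= x.
  by case: (leP y x) => [h|/ltW h] => [|/(_ _ _ h)]; [apply|rewrite distrC [leRHS]distrC].
have [z _ ->] := @MVT_segment R (@atan R) (fun z => (1 + z ^+ 2)^-1) y x xy
  (fun z _ => is_derive1_atan z)
  (continuous_subspaceT (fun z => @continuous_atan R z)).
rewrite normrM ler_piMl// ger0_norm; last first.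
  by rewrite invr_ge0 addr_ge0 ?sqr_ge0.
by rewrite invf_le1 ?lerDl ?sqr_ge0// ltr_wpDr ?sqr_ge0.
Qed.

Lemma norm3_ge (R : realType) (v : R * R * R) :
  [/\ `|v.1.1| <= norm3 v, `|v.1.2| <= norm3 v & `|v.2| <= norm3 v].
Proof.
have h (x y z : R) : `|x| <= Num.sqrt (x ^+ 2 + y ^+ 2 + z ^+ 2).
  by rewrite -sqrtr_sqr ler_wsqrtr// -addrA lerDl addr_ge0 ?sqr_ge0.
rewrite /norm3; split; first exact: h.
  by rewrite [v.1.1 ^+ 2 + _]addrC; exact: h.
by rewrite addrC addrA; exact: h.
Qed.

Lemma norm2_le (R : realType) (v : R * R) : norm2 v <= `|v.1| + `|v.2|.
Proof.
rewrite /norm2 -[leRHS]ger0_norm ?addr_ge0// -sqrtr_sqr ler_wsqrtr//.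
rewrite -[v.1 ^+ 2]real_normK ?num_real// -[v.2 ^+ 2]real_normK ?num_real//.
have := normr_ge0 v.1; have := normr_ge0 v.2; nra.
Qed.

(** The maximum in [chart] keeps the denominators [u] and [v] above [r / 2], so [r / u] and [r / v]
    are at most 2 and the first coordinate has constant 2 * 2 + 2 * 2 * 2 = 12; the height adds
    1. *)
Lemma chart_lipschitz (R : realType) (r : R) (p q : R * R * R) : 0 < r ->
  sphere r p -> sphere r q ->
  `|(chart r p).1 - (chart r q).1| + `|(chart r p).2 - (chart r q).2| <=
  13 * norm3 (q - p).
Proof.
move=> r0 pr qr; have [ex' ey' ez'] := norm3_ge (q - p).
set e := norm3 (q - p) in ex' ey' ez' *.
have ex : `|p.1.1 - q.1.1| <= e by rewrite distrC.
have ey : `|p.1.2 - q.1.2| <= e by rewrite distrC.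
have ez : `|p.2 - q.2| <= e by rewrite distrC.
have [qx _ _] := norm3_ge q; rewrite qr in qx.
rewrite /chart/=.
set u := Num.max `|p.1.2| (r / 2); set v := Num.max `|q.1.2| (r / 2).
have ru : r / 2 <= u by rewrite le_max lexx orbT.
have rv : r / 2 <= v by rewrite le_max lexx orbT.
have uv : `|v - u| <= e.
  apply: le_trans ey; rewrite distrC.
  apply: (@le_trans _ _ `| `|p.1.2| - `|q.1.2| |); last exact: ler_dist_dist.
  rewrite /u /v; case: (leP `|p.1.2|) => hu; case: (leP `|q.1.2|) => hv;
    rewrite ?subrr//; rewrite ler_norml; apply/andP; split;
    have := ler_norm (`|p.1.2| - `|q.1.2|);
    have := ler_norm (- (`|p.1.2| - `|q.1.2|)); rewrite normrN; lra.
have u0 : 0 < u by lra.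
have v0 : 0 < v by lra.
have e0 : 0 <= e := le_trans (normr_ge0 _) ex.
suff : 2 * r * `|p.1.1 / u - q.1.1 / v| <= 12 * e.
  move=> h; rewrite -mulrBr normrM gtr0_norm ?mulr_gt0//.
  have := @atan_lipschitz R (p.1.1 / u) (q.1.1 / v).
  by move=> /(ler_wpM2l (ltW (mulr_gt0 (ltr0n _ 2) r0))); lra.
have -> : p.1.1 / u - q.1.1 / v = (p.1.1 - q.1.1) / u + q.1.1 * (v - u) / (u * v).
  by field; rewrite !gt_eqF.
apply: (@le_trans _ _ (2 * r * (e / u + r * e / (u * v)))).
  apply: ler_wpM2l; first lra.
  rewrite (le_trans (ler_normD _ _))// lerD//.
    by rewrite normrM [`|u^-1|]gtr0_norm ?invr_gt0// ler_wpM2r// invr_ge0 ltW.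
  rewrite !normrM [`|(u * v)^-1|]gtr0_norm ?invr_gt0 ?mulr_gt0//.
  by rewrite ler_wpM2r ?ler_pM// invr_ge0 ltW// mulr_gt0.
have -> : 2 * r * (e / u + r * e / (u * v)) = e * (2 * (r / u) + 2 * ((r / u) * (r / v))).
  by field; rewrite !gt_eqF.
have ru2 : r / u <= 2 by rewrite ler_pdivrMr//; lra.
have rv2 : r / v <= 2 by rewrite ler_pdivrMr//; lra.
have ru0 : 0 <= r / u by rewrite divr_ge0// ltW.
have rv0 : 0 <= r / v by rewrite divr_ge0// ltW.
rewrite [leRHS]mulrC ler_wpM2l//; nra.
Qed.

(** * Grid cells in the chart and the law of a patch *)

Definition grid_cell (R : realType) (h : R) (v : R * R) : int * int :=
  (Num.floor (v.1 / h), Num.floor (v.2 / h)).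

Lemma floor_dist (R : realType) (x y : R) :
  `|Num.floor x - Num.floor y|%:~R <= `|x - y| + 1.
Proof.
have /andP[x1 x2] := floor_itv x; have /andP[y1 y2] := floor_itv y.
rewrite intr_norm intrB ler_norml; rewrite !intrD in x2 y2.
have := ler_norm (x - y); have := ler_norm (- (x - y)); rewrite normrN => *.
by apply/andP; split; lra.
Qed.

Lemma zdist_grid_cell (R : realType) (h : R) (v w : R * R) : 0 < h ->
  zdist R (grid_cell h v) (grid_cell h w) <=
  (`|v.1 - w.1| + `|v.2 - w.2|) / h + 2.
Proof.
move=> h0; rewrite /zdist intrD /grid_cell/=.
have e1 (x y : R) : `|x - y| / h = `|x / h - y / h|.
  by rewrite -mulrBl normrM [`|h^-1|]gtr0_norm ?invr_gt0.
have := floor_dist (v.1 / h) (w.1 / h); have := floor_dist (v.2 / h) (w.2 / h).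
by rewrite mulrDl !e1; lra.
Qed.

Lemma measurable_chart (R : realType) (r : R) : 0 < r ->
  measurable_fun setT (fun p : R * R * R => (chart r p).1) /\
  measurable_fun setT (fun p : R * R * R => (chart r p).2).
Proof.
move=> r0; split; last exact: measurable_snd.
have m1 : measurable_fun setT (fun p : R * R * R => p.1.1).
  by apply: measurableT_comp => //; exact: measurable_fst.
have m2 : measurable_fun setT (fun p : R * R * R => p.1.2).
  by apply: measurableT_comp => //; exact: measurable_fst.
apply: measurable_funM => //; apply: measurableT_comp.
  by apply: continuous_measurable_fun => x; exact: continuous_atan.
apply: measurable_funM => //.
apply: (@measurableT_comp _ _ _ _ _ _ (fun y : R => (Num.max `|y| (r / 2))^-1)) => //.
apply: continuous_measurable_fun => y.
have u0 : 0 < Num.max `|y| (r / 2) by rewrite lt_max divr_gt0 ?orbT.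
apply: cvgV; first by rewrite gt_eqF.
apply: (@continuous_max _ _ (fun y : R => `|y|) (cst (r / 2))).
  exact: norm_continuous.
exact: cst_continuous.
Qed.

Lemma measurable_preimage_co (R : realType) (d : measure_display)
    (V : measurableType d) (f : V -> R) (a b : R) :
  measurable_fun setT f -> measurable [set p | a <= f p < b].
Proof.
move=> mf; rewrite (_ : mkset _ = setT `&` f @^-1` `[a, b[%classic).
  by apply: mf => //; exact: measurable_itv.
by rewrite setTI; apply/seteqP; split => p /=; rewrite in_itv.
Qed.

Lemma measurable_chart_box (R : realType) (r a b c d : R) : 0 < r ->
  measurable [set p | a <= (chart r p).1 < b /\ c <= (chart r p).2 < d].
Proof.
move=> r0; have [m1 m2] := measurable_chart r0.
by apply: measurableI; exact: measurable_preimage_co.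
Qed.

Lemma measurable_norm3 (R : realType) :
  measurable_fun setT (@norm3 R).
Proof.
have m1 : measurable_fun setT (fun p : R * R * R => p.1.1).
  by apply: measurableT_comp => //; exact: measurable_fst.
have m2 : measurable_fun setT (fun p : R * R * R => p.1.2).
  by apply: measurableT_comp => //; exact: measurable_fst.
have m3 : measurable_fun setT (fun p : R * R * R => p.2) by exact: measurable_snd.
apply: measurableT_comp.
  by apply: continuous_measurable_fun; exact: sqrt_continuous.
by repeat (apply: measurable_funD || apply: measurable_funX).
Qed.

Lemma measurable_norm2 (R : realType) :
  measurable_fun setT (@norm2 R).
Proof.
have m1 : measurable_fun setT (fun p : R * R => p.1) by exact: measurable_fst.
have m2 : measurable_fun setT (fun p : R * R => p.2) by exact: measurable_snd.
apply: measurableT_comp.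
  by apply: continuous_measurable_fun; exact: sqrt_continuous.
by repeat (apply: measurable_funD || apply: measurable_funX).
Qed.

Lemma sphere_areaI (R : realType) (r : R) (E : set (R * R * R)) : 0 <= r ->
  sphere_area r (E `&` sphere r) = sphere_area r E.
Proof.
move=> r0; rewrite /sphere_area (_ : spherical r @^-1` _ = spherical r @^-1` E)//.
by apply/seteqP; split => t /= => [[]//|Et]; split => //; exact: spherical_on_sphere.
Qed.

Lemma measurable_sphere (R : realType) (r : R) : measurable (sphere r).
Proof.
rewrite (_ : sphere r = setT `&` @norm3 R @^-1` [set r]); last by rewrite setTI.
exact: measurable_norm3.
Qed.

Lemma uniform_on_support (R : realType) (d d' : measure_display)
    (T : measurableType d) (V : measurableType d') (P : probability T R)
    (mu : set V -> \bar R) (S : set V) (X : {RV P >-> V}) :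
  measurable S -> mu set0 = 0%E -> uniform_on mu S X ->
  P (X @^-1` ~` S) = 0%E.
Proof.
move=> mS mu0 /(_ _ (measurableC mS)).
by rewrite setICl mu0 mul0e.
Qed.

Lemma sphere_prob_box (R : realType) (r a b c d : R) (e : measure_display)
    (T : measurableType e) (P : probability T R) (X : {RV P >-> (R * R * R)%type}) :
  0 < r -> 0 <= a -> a <= b -> b <= r / 2 -> 0 <= c -> c <= d -> d <= r / 2 ->
  uniform_on (sphere_area r) (sphere r) X ->
  P (X @^-1` [set p | a <= (chart r p).1 < b /\ c <= (chart r p).2 < d]) =
  ((b - a) * (d - c) / (4 * pi * r ^+ 2))%:E.
Proof.
move=> r0 a0 ab br c0 cd dr /(_ _ (measurable_chart_box a b c d r0)).
rewrite sphere_areaI ?ltW// sphere_area_chart// sphere_area_sphere ?ltW//.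
by rewrite inver gt_eqF -?EFinM// !mulr_gt0 ?pi_gt0 ?exprn_gt0.
Qed.

Definition patch_of (R : realType) (r h : R) (m : nat) (t : nat * nat)
    (p : R * R * R) : option ('I_m * 'I_m) :=
  patch m t (grid_cell h (chart r p)).

Lemma floor_eq_scaled (R : realType) (h x : R) (k : nat) : 0 < h ->
  (Num.floor (x / h) == k%:Z) = (k%:R * h <= x < k.+1%:R * h).
Proof.
move=> h0; rewrite floor_eq ler_pdivlMr// ltr_pdivrMr//.
by rewrite intrD -pmulrn natr1.
Qed.

Lemma in_win_floor (R : realType) (h x : R) (m t : nat) : 0 < h ->
  in_win m t (Num.floor (x / h)) = (t%:R * h <= x < (t + m)%:R * h).
Proof.
move=> h0; rewrite /in_win floor_ge_int floor_lt_int ler_pdivlMr// ltr_pdivrMr//.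
Qed.

Lemma patch_of_some (R : realType) (r h : R) (m : nat) (t : nat * nat)
    (q : 'I_m * 'I_m) : 0 < h ->
  @patch_of R r h m t @^-1` [set Some q] =
  [set p | (t.1 + q.1)%:R * h <= (chart r p).1 < (t.1 + q.1).+1%:R * h /\
           (t.2 + q.2)%:R * h <= (chart r p).2 < (t.2 + q.2).+1%:R * h].
Proof.
move=> h0; apply/seteqP; split => p /=.
  move=> /eqP; rewrite /patch_of patch_eq_some /grid_cell xpair_eqE/=.
  by rewrite -!PoszD !floor_eq_scaled// => /andP.
move=> [h1 h2]; apply/eqP; rewrite /patch_of patch_eq_some /grid_cell xpair_eqE/=.
by rewrite -!PoszD !floor_eq_scaled// h1.
Qed.

Lemma patch_of_none (R : realType) (r h : R) (m : nat) (t : nat * nat) : 0 < h ->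
  @patch_of R r h m t @^-1` [set None] =
  ~` [set p | t.1%:R * h <= (chart r p).1 < (t.1 + m)%:R * h /\
              t.2%:R * h <= (chart r p).2 < (t.2 + m)%:R * h].
Proof.
move=> h0; apply/seteqP; split => p /=; rewrite -!in_win_floor// -!wcell_isSome;
  rewrite /patch_of /patch /grid_cell /=.
  by case: wcell => [i|]; case: wcell => [j|] //= _ [].
by case: wcell => [i|]; case: wcell => [j|] //= /(_ (conj isT isT)).
Qed.

Lemma measurable_patch_of (R : realType) (r h : R) (m : nat) (t : nat * nat)
    (u : option ('I_m * 'I_m)) : 0 < r -> 0 < h ->
  measurable (@patch_of R r h m t @^-1` [set u]).
Proof.
move=> r0 h0; case: u => [q|]; last first.
  by rewrite patch_of_none//; apply: measurableC; exact: measurable_chart_box.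
by rewrite patch_of_some//; exact: measurable_chart_box.
Qed.

(** The bound [L] keeps the whole translate in the square of side [r / 2], where the chart preserves
    area. The resulting law does not depend on [t], which is what makes averaging over translates
    possible. *)
Lemma patch_of_law (R : realType) (r h : R) (m L : nat) (t : nat * nat)
    (e : measure_display) (T : measurableType e) (P : probability T R)
    (X : {RV P >-> (R * R * R)%type}) (u : option ('I_m * 'I_m)) :
  0 < r -> 0 < h -> (0 < m)%N -> (t.1 + m <= L)%N -> (t.2 + m <= L)%N ->
  L%:R * h <= r / 2 ->
  uniform_on (sphere_area r) (sphere r) X ->
  P (X @^-1` (@patch_of R r h m t @^-1` [set u])) =
  (omass ((m%:R * h) ^+ 2 / (4 * pi * r ^+ 2)) u)%:E.
Proof.
move=> r0 h0 m0 tL1 tL2 Lr Xu.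
have le_r k : (k <= L)%N -> k%:R * h <= r / 2.
  by move=> kL; apply: le_trans Lr; rewrite ler_pM2r// ler_nat.
have ge0 k : 0 <= k%:R * h by rewrite mulr_ge0// ltW.
have leS k k' : (k <= k')%N -> k%:R * h <= k'%:R * h.
  by move=> kk'; rewrite ler_pM2r// ler_nat.
have mR : m%:R != 0 :> R by rewrite pnatr_eq0 -lt0n.
case: u => [[i j]|].
  rewrite patch_of_some// sphere_prob_box//=; try exact: leS;
    try (by apply: le_r; have := ltn_ord i; have := ltn_ord j; lia).
  congr EFin; rewrite card_prod card_ord natrM -!natr1.
  by move: (@pi R) (pi_gt0 R) => w w0; field; rewrite mR !gt_eqF.
rewrite patch_of_none// -preimage_setC probability_setC; last first.
  rewrite -[X in measurable X]setTI.
  by apply: measurable_funP => //; exact: measurable_chart_box.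
rewrite sphere_prob_box//=; try exact: le_r; try (by apply: leS; lia).
rewrite -EFinB; congr EFin; rewrite !natrD.
by move: (@pi R) (pi_gt0 R) => w w0; field; rewrite !gt_eqF.
Qed.

(** * Cells of the planar square *)

(** The minimum puts the right end [m.+1 * h] of the closed interval into the last cell. *)
Definition square_cell (R : realType) (m : nat) (h x : R) : 'I_m.+1 :=
  inord (minn (Num.truncn (x / h)) m).

Lemma square_cell_gt (R : realType) (m : nat) (h x : R) (i : nat) : 0 < h ->
  (i < square_cell m h x)%N = ((i < m)%N && (i.+1%:R * h <= x)).
Proof.
move=> h0; rewrite inordK ?ltnS ?geq_minr// leq_min truncn_gt_nat.
by rewrite ler_pdivlMr// andbC.
Qed.

Lemma square_cell_eq (R : realType) (m : nat) (h x : R) (i : 'I_m.+1) : 0 < h ->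
  square_cell m h x = i <->
  ((0 < i)%N -> i%:R * h <= x) /\ ((i < m)%N -> x < i.+1%:R * h).
Proof.
move=> h0; split.
  move=> e; split => [i0|im].
    have : (i.-1 < square_cell m h x)%N by rewrite e; lia.
    by rewrite square_cell_gt// prednK// => /andP[].
  have : (i < square_cell m h x)%N = false by rewrite e ltnn.
  by rewrite square_cell_gt// im/= ltNge => ->.
move=> [h1 h2]; apply: val_inj => /=; apply/eqP; rewrite eqn_leq; apply/andP; split.
  rewrite leqNgt square_cell_gt//; apply/negP => /andP[im].
  by rewrite leNgt h2.
case: (posnP i) => [->//|i0].
have := @square_cell_gt R m h x i.-1 h0; rewrite prednK// h1// andbT => ->.
by have := ltn_ord i; lia.
Qed.

Lemma measurable_square_cell (R : realType) (m : nat) (h : R) (i : 'I_m.+1) :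
  0 < h -> measurable (square_cell m h @^-1` [set i]).
Proof.
move=> h0; rewrite (_ : _ @^-1` _ =
    [set x | (0 < i)%N -> i%:R * h <= x] `&` [set x | (i < m)%N -> x < i.+1%:R * h]).
  apply: measurableI.
    case: (posnP i) => [->|i0].
      by rewrite (_ : mkset _ = setT)//; apply/seteqP; split.
    rewrite (_ : mkset _ = `[i%:R * h, +oo[%classic).
      exact: measurable_itv.
    by apply/seteqP; split => x /=; rewrite in_itv/= andbT// => /(_ isT).
  case: (ltnP i m) => im.
    rewrite (_ : mkset _ = `]-oo, i.+1%:R * h[%classic).
      exact: measurable_itv.
    by apply/seteqP; split => x /=; rewrite in_itv/=// => /(_ isT).
  by rewrite (_ : mkset _ = setT)//; apply/seteqP; split.
by apply/seteqP; split => x /= /square_cell_eq; exact.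
Qed.

(** The boolean [i < m] makes the right bound open, except for the last cell, which is closed. *)
Lemma square_cell_itv (R : realType) (m : nat) (h l : R) (i : 'I_m.+1) :
  0 < h -> l = m.+1%:R * h ->
  square_cell m h @^-1` [set i] `&` `[0, l] =
  [set` Interval (BSide true (i%:R * h)) (BSide (i < m)%N (i.+1%:R * h))].
Proof.
move=> h0 lE; apply/seteqP; split => x.
  move=> [/= /square_cell_eq -/(_ h0) [h1 h2]]; rewrite !in_itv/= => /andP[x0 xl].
  apply/andP; split.
    by case: (posnP i) => [->|/h1//]; rewrite mul0r.
  case: (ltnP i m) => im /=; first exact: h2.
  have -> : (i : nat) = m by have := ltn_ord i; lia.
  by rewrite -lE.
rewrite /= !in_itv/= => /andP[x1 x2].
have x0 : 0 <= x by rewrite (le_trans _ x1)// mulr_ge0// ltW.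
split.
  apply/square_cell_eq => //; split => // im.
  by move: x2; rewrite im.
rewrite x0/= lE; case: (ltnP i m) x2 => im x2 /=.
  by rewrite (le_trans (ltW x2))// ler_pM2r// ler_nat ltnS ltnW.
have e : (i : nat) = m by have := ltn_ord i; lia.
by rewrite -[X in X.+1%:R]e.
Qed.

Definition square_cell2 (R : realType) (m : nat) (h : R) (p : R * R) :
    'I_m.+1 * 'I_m.+1 :=
  (square_cell m h p.1, square_cell m h p.2).

Lemma square_cell2E (R : realType) (m : nat) (h : R) (q : 'I_m.+1 * 'I_m.+1) :
  square_cell2 m h @^-1` [set q] =
  (square_cell m h @^-1` [set q.1]) `*` (square_cell m h @^-1` [set q.2]).
Proof.
apply/seteqP; split => -[x y] /=; rewrite /square_cell2/=; first by move=> <-.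
by case: q => q1 q2 /= [-> ->].
Qed.

Lemma measurable_square_cell2 (R : realType) (m : nat) (h : R)
    (q : 'I_m.+1 * 'I_m.+1) : 0 < h ->
  measurable (square_cell2 m h @^-1` [set q]).
Proof.
move=> h0; rewrite square_cell2E.
by apply: measurableX; exact: measurable_square_cell.
Qed.

Lemma square_cell2_law (R : realType) (m : nat) (h l : R) (e : measure_display)
    (T : measurableType e) (P : probability T R) (A : {RV P >-> (R * R)%type})
    (q : 'I_m.+1 * 'I_m.+1) :
  0 < h -> l = m.+1%:R * h -> uniform_on (@lebesgue2 R) (square l) A ->
  P (A @^-1` (square_cell2 m h @^-1` [set q])) = (umass R q)%:E.
Proof.
move=> h0 lE /(_ _ (measurable_square_cell2 q h0)) lawq.
rewrite -[LHS]/(distribution P A _) lawq.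
have l0 : 0 < l by rewrite lE mulr_gt0.
have -> : square_cell2 m h @^-1` [set q] `&` square l =
    (square_cell m h @^-1` [set q.1] `&` `[0, l]) `*`
    (square_cell m h @^-1` [set q.2] `&` `[0, l]).
  rewrite square_cell2E; apply/seteqP; split => -[x y] /=.
    by move=> [[? ?] [? ?]].
  by move=> [[? ?] [? ?]].
rewrite !(@square_cell_itv _ _ _ l)// /lebesgue2 /square.
rewrite !product_measure1E//; [|exact: measurable_itv..].
have leS (k : nat) : k%:R * h <= k.+1%:R * h by rewrite ler_pM2r// ler_nat.
have mi (i : nat) (b : bool) : lebesgue_measure
    [set` Interval (BSide true (i%:R * h)) (BSide b (i.+1%:R * h))] = h%:E.
  by rewrite lebesgue_measure_bnd// -natr1; congr EFin; ring.
have ml : lebesgue_measure `[0, l]%classic = l%:E.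
  by rewrite lebesgue_measure_bnd ?subr0// ltW.
transitivity ((h%:E * h%:E) / (l%:E * l%:E))%E.
  by congr (_ * _ / (_ * _))%E; [exact: mi|exact: mi|exact: ml|exact: ml].
rewrite -!EFinM inver gt_eqF ?mulr_gt0// -EFinM; congr EFin.
rewrite /umass card_prod !card_ord natrM lE.
have w0 : 0 < m.+1%:R :> R by [].
by move: (m.+1%:R : R) w0 => w w0; field; rewrite !gt_eqF.
Qed.

Lemma square_cell_dist (R : realType) (m : nat) (h l x y : R) : 0 < h ->
  l = m.+1%:R * h -> 0 <= x <= l -> 0 <= y <= l ->
  `|x - y| <= h * (`|(square_cell m h x : nat)%:Z -
                     (square_cell m h y : nat)%:Z|%:~R + 1).
Proof.
move=> h0 lE xl yl.
have itv z : 0 <= z <= l -> (square_cell m h z)%:R * h <= z <=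
    (square_cell m h z)%:R * h + h.
  move=> zl; have : (square_cell m h @^-1` [set square_cell m h z] `&` `[0, l]) z.
    by split => //=; rewrite in_itv.
  rewrite (@square_cell_itv _ _ _ l)//= in_itv/= -natr1 mulrDl mul1r => /andP[-> zh]/=.
  by case: (_ < m)%N zh => //= /ltW.
have /andP[x1 x2] := itv _ xl; have /andP[y1 y2] := itv _ yl.
set i := square_cell m h x in x1 x2 *; set j := square_cell m h y in y1 y2 *.
rewrite intr_norm intrB -!pmulrn.
have k1 := ler_norm (i%:R - j%:R : R).
have k2 := ler_norm (- (i%:R - j%:R) : R); rewrite normrN in k2.
rewrite ler_norml; apply/andP; split; nra.
Qed.

Lemma norm2_square_cell (R : realType) (m : nat) (h l : R) (p q : R * R) : 0 < h ->
  l = m.+1%:R * h -> square l p -> square l q ->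
  norm2 (q - p) <= h * qdist R (square_cell2 m h p) (square_cell2 m h q) + 2 * h.
Proof.
move=> h0 lE [/=]; rewrite !in_itv/= => p1 p2 [/=]; rewrite !in_itv/= => q1 q2.
apply: (le_trans (norm2_le _)); rewrite /qdist /zdist/= intrD.
have := square_cell_dist h0 lE p1 q1; have := square_cell_dist h0 lE p2 q2.
by rewrite !(distrC (q.1)) !(distrC (q.2)); lra.
Qed.

(** * Comparison with the discrete problem *)

Lemma measurable_fin_comp (R : realType) (d : measure_display)
    (T : measurableType d) (U : finType) (z : T -> U) (F : U -> R) :
  (forall u, measurable (z @^-1` [set u])) ->
  measurable_fun setT (fun w => F (z w)).
Proof.
move=> mz _ Y mY; rewrite setTI.
rewrite (_ : _ @^-1` Y = \bigcup_(u in F @^-1` Y) (z @^-1` [set u])).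
  by apply: fin_bigcup_measurable => //; exact: finite_finset.
by apply/seteqP; split => w /=; [move=> Fw; exists (z w)|move=> [u Fu /= ->]].
Qed.

Lemma measurable_assign (R : realType) (d : measure_display)
    (T : measurableType d) (n : nat) (w : T -> 'I_n -> 'I_n -> R) :
  (forall i j, measurable_fun setT (fun x => w x i j)) ->
  measurable_fun setT (fun x => assign (w x)).
Proof.
move=> mw.
have mcost (s : 'S_n) :
    measurable_fun setT (fun x => \sum_(i < n) w x i (s i)).
  by apply: measurable_sum => i; exact: mw.
(* The induction is on the list of permutations; the initial value of the minimum, the cost of the
   identity, stays fixed. *)
suff mr (r : seq {perm 'I_n}) : measurable_fun setT (fun x =>
    \big[Num.min/(\sum_(i < n) w x i ((1%g : 'S_n) i))]_(s <- r)
      \sum_(i < n) w x i (s i)).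
  exact: mr.
elim: r => [|s r IH]; first by under eq_fun do rewrite big_nil; exact: mcost.
by under eq_fun do rewrite big_cons; exact: measurable_minr.
Qed.

Lemma measurable_norm3B (R : realType) (d : measure_display)
    (T : measurableType d) (f g : T -> R * R * R) :
  measurable_fun setT f -> measurable_fun setT g ->
  measurable_fun setT (fun w => norm3 (f w - g w)).
Proof.
move=> mf mg.
have m1 (k : T -> R * R * R) : measurable_fun setT k ->
    [/\ measurable_fun setT (fun w => (k w).1.1),
        measurable_fun setT (fun w => (k w).1.2) &
        measurable_fun setT (fun w => (k w).2)].
  move=> mk; have mk1 : measurable_fun setT (fun w => (k w).1).
    exact: measurableT_comp measurable_fst mk.
  split; first exact: measurableT_comp measurable_fst mk1.
    exact: measurableT_comp measurable_snd mk1.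
  exact: measurableT_comp measurable_snd mk.
have [f1 f2 f3] := m1 _ mf; have [g1 g2 g3] := m1 _ mg.
apply: (measurableT_comp (@measurable_norm3 R)).
by apply: measurable_fun_pair; [apply: measurable_fun_pair|]; exact: measurable_funB.
Qed.

Lemma measurable_norm2B (R : realType) (d : measure_display)
    (T : measurableType d) (f g : T -> R * R) :
  measurable_fun setT f -> measurable_fun setT g ->
  measurable_fun setT (fun w => norm2 (f w - g w)).
Proof.
move=> mf mg; apply: (measurableT_comp (@measurable_norm2 R)).
by apply: measurable_fun_pair; apply: measurable_funB;
  (exact: measurableT_comp measurable_fst _ || exact: measurableT_comp measurable_snd _).
Qed.

Lemma ae_uniform_support (R : realType) (d d' : measure_display)
    (T : measurableType d) (V : measurableType d') (P : probability T R)
    (mu : set V -> \bar R) (S : set V) (I : finType) (X : I -> {RV P >-> V}) :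
  measurable S -> mu set0 = 0%E -> (forall i, uniform_on mu S (X i)) ->
  {ae P, forall w, forall i, S (X i w)}.
Proof.
move=> mS mu0 Xu; apply: filter_forall => i.
exists (X i @^-1` ~` S); split => //.
- rewrite -[X in measurable X]setTI.
  by apply: measurable_funP => //; exact: measurableC.
- exact: uniform_on_support mu0 (Xu i).
Qed.

(** The estimate by cells fails outside the square, where [square_cell] clamps, so the integrands
    are compared only almost everywhere. *)
Lemma planar_expectation_le (R : realType) (m n : nat) (h l : R)
    (d : measure_display) (T : measurableType d) (P : probability T R)
    (A B : 'I_n -> {RV P >-> (R * R)%type}) :
  0 < h -> l = m.+1%:R * h ->
  iid_uniform (@lebesgue2 R) (square l) (join_families A B) ->
  ('E_P[fun w => min_matching (@norm2 R) (A ^~ w) (B ^~ w)] <=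
   (h * pexp (@umass R ('I_m.+1 * 'I_m.+1)%type) (fun a : {ffun 'I_n -> _} =>
      pexp (@umass R _) (fun b : {ffun 'I_n -> _} => matchc (@qdist R m.+1) a b)) +
    2 * h * n%:R)%:E)%E.
Proof.
move=> h0 lE [indep unif].
pose Q : finType := ('I_m.+1 * 'I_m.+1)%type.
pose F (z : {ffun 'I_n + 'I_n -> Q}) : R :=
  h * matchc (@qdist R m.+1) (fun i => z (inl i)) (fun i => z (inr i)) + 2 * h * n%:R.
have F0 z : 0 <= F z.
  rewrite addr_ge0 ?mulr_ge0 1?(ltW h0)//.
  by apply: assign_ge0 => i j; have /andP[] := qdist_le R (z (inl i)) (z (inr j)).
have mcell q := @measurable_square_cell2 R m h q h0.
have := iid_expectation mcell indep
  (fun i q => square_cell2_law q h0 lE (unif i)) F0.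
have -> : pexp (@umass R Q) F = h * pexp (@umass R Q) (fun a : {ffun 'I_n -> Q} =>
      pexp (@umass R Q) (fun b : {ffun 'I_n -> Q} => matchc (@qdist R m.+1) a b)) +
    2 * h * n%:R.
  have Q0 : (0 < #|Q|)%N by rewrite card_prod card_ord.
  have u1 := sum_umass R Q0.
  rewrite pexp_sumtype -pexpZ -[X in _ = _ + X](@pexp_cst R 'I_n Q (@umass R Q))//.
  rewrite -pexpD; apply: eq_pexp => a.
  rewrite -pexpZ -[X in _ = _ + X](@pexp_cst R 'I_n Q (@umass R Q))// -pexpD.
  apply: eq_pexp => b; congr (h * _ + _).
  by apply: matchc_ext => i; rewrite ffunE.
move=> <-; rewrite unlock.
have mS : measurable (square l) by apply: measurableX; exact: measurable_itv.
apply: ae_ge0_le_integral => //.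
- move=> w _; rewrite lee_fin min_matchingE.
  by apply: assign_ge0 => i j; exact: sqrtr_ge0.
- apply/measurable_EFinP; under eq_fun do rewrite min_matchingE.
  apply: measurable_assign => i j.
  by apply: measurable_norm2B.
- by move=> w _; rewrite lee_fin.
- apply/measurable_EFinP; apply: (@measurable_fin_comp R _ _ _
    (fun w => [ffun i => square_cell2 m h (join_families A B i w)])) => z.
  exact: measurable_ffun_preimage.
have mu0 : lebesgue2 (set0 : set (R * R)) = 0%E by rewrite /lebesgue2 measure0.
have := ae_uniform_support mS mu0 unif.
apply: filterS => w supp _; rewrite lee_fin /F.
rewrite min_matchingE; apply: assign_affine => [|i j]; first exact: ltW.
rewrite !ffunE; apply: (norm2_square_cell h0 lE).
- exact: (supp (inl i)).
- exact: (supp (inr j)).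
Qed.

Lemma expectation_affine (R : realType) (d : measure_display)
    (T : measurableType d) (P : probability T R) (f : T -> R) (a b : R) :
  measurable_fun setT f -> (forall w, 0 <= f w) -> 0 <= a -> 0 <= b ->
  (\int[P]_w (a * f w + b)%:E = a%:E * 'E_P[f] + b%:E)%E.
Proof.
move=> mf f0 a0 b0; rewrite unlock.
rewrite -[b%:E in RHS]mule1 -(probability_setT P) -integral_cst//.
rewrite -ge0_integralZl ?lee_fin//;
  [|exact/measurable_EFinP|by move=> w _; rewrite lee_fin].
rewrite -ge0_integralD//.
- by move=> w _; rewrite lee_fin mulr_ge0.
- by apply/measurable_EFinP; exact: measurable_funM.
Qed.

(** The sum over translates is bounded for each configuration on the sphere, before taking
    expectations. The factor [13 / h] is the Lipschitz constant of the chart in grid units, and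
    [2 * N] collects a rounding error 2 per edge. *)
Lemma sphere_expectation_ge (R : realType) (K m N : nat) (h r p : R)
    (d : measure_display) (T : measurableType d) (P : probability T R)
    (X Y : 'I_N -> {RV P >-> (R * R * R)%type}) :
  0 < h -> 0 < r -> (0 < m)%N -> (K + m)%:R * h <= r / 2 ->
  iid_uniform (sphere_area r) (sphere r) (join_families X Y) ->
  p = (m%:R * h) ^+ 2 / (4 * pi * r ^+ 2) ->
  ((K%:R ^+ 2 *
    pexp (@omass R _ p) (fun x : {ffun 'I_N -> option ('I_m * 'I_m)%type} =>
      pexp (@omass R _ p) (fun y : {ffun 'I_N -> option ('I_m * 'I_m)%type} =>
        matchc (ocost (@qdist R m) m%:R) x y)))%:E <=
   (5 * m%:R ^+ 2 * (13 / h))%:E *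
     'E_P[fun w => min_matching (@norm3 R) (X ^~ w) (Y ^~ w)] +
   (5 * m%:R ^+ 2 * (2 * N%:R))%:E)%E.
Proof.
move=> h0 r0 m0 KmL [indep unif] pE.
pose mu := @omass R ('I_m * 'I_m)%type p.
pose Q : finType := option ('I_m * 'I_m)%type.
pose F (z : {ffun 'I_N + 'I_N -> Q}) : R :=
  matchc (ocost (@qdist R m) m%:R) (fun i => z (inl i)) (fun i => z (inr i)).
have F0 z : 0 <= F z.
  by apply: assign_ge0 => i j; apply: ocost_ge0.
pose Z (t : 'I_K * 'I_K) w : {ffun 'I_N + 'I_N -> Q} :=
  [ffun i => patch_of r h m (t.1 : nat, t.2 : nat) (join_families X Y i w)].
have mcell (t : 'I_K * 'I_K) q :
    measurable (@patch_of R r h m (t.1 : nat, t.2 : nat) @^-1` [set q]).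
  exact: measurable_patch_of.
have mZ t z : measurable (Z t @^-1` [set z]).
  exact: measurable_ffun_preimage (mcell t).
have mFZ t : measurable_fun setT (fun w => F (Z t w)).
  exact: measurable_fin_comp (mZ t).
have EZ t : ('E_P[fun w => F (Z t w)] = (pexp mu F)%:E)%E.
  apply: iid_expectation => // i q.
  rewrite /mu pE; apply: patch_of_law KmL (unif i) => //=;
    have := ltn_ord t.1; have := ltn_ord t.2; lia.
have -> : pexp (@omass R _ p) (fun x : {ffun 'I_N -> option ('I_m * 'I_m)%type} =>
      pexp (@omass R _ p) (fun y : {ffun 'I_N -> option ('I_m * 'I_m)%type} =>
        matchc (ocost (@qdist R m) m%:R) x y)) = pexp mu F.
  rewrite [RHS]pexp_sumtype; apply: eq_pexp => x; apply: eq_pexp => y.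
  by apply: matchc_ext => i; rewrite ffunE.
(* All [K ^ 2] translates have the same expectation. *)
have -> : (K%:R ^+ 2 * pexp mu F)%:E =
    (\int[P]_w \sum_(t : 'I_K * 'I_K) (F (Z t w))%:E)%E.
  rewrite ge0_integral_sum//; last by move=> t w _; rewrite lee_fin.
    have EZ' t : (\int[P]_w (F (Z t w))%:E = (pexp mu F)%:E)%E by rewrite -(EZ t) unlock.
    under eq_bigr => t _ do rewrite EZ'.
    rewrite sumEFin sumr_const card_prod card_ord; congr EFin.
    by rewrite -[RHS]mulr_natl natrM expr2.
  by move=> t; apply/measurable_EFinP.
have mmin : measurable_fun setT (fun w =>
    min_matching (@norm3 R) (X ^~ w) (Y ^~ w)).
  under eq_fun do rewrite min_matchingE.
  by apply: measurable_assign => i j; exact: measurable_norm3B.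
have min0 w : 0 <= min_matching (@norm3 R) (X ^~ w) (Y ^~ w).
  by rewrite min_matchingE; apply: assign_ge0 => i j; exact: sqrtr_ge0.
have h13 : 0 <= 13 / h by rewrite divr_ge0// ltW.
have c1 : 0 <= 5 * m%:R ^+ 2 * (13 / h) by rewrite mulr_ge0// mulr_ge0// exprn_ge0.
have c2 : 0 <= 5 * m%:R ^+ 2 * (2 * N%:R) :> R.
  by rewrite mulr_ge0 ?mulr_ge0// exprn_ge0.
rewrite -expectation_affine//.
apply: ae_ge0_le_integral => //.
- by move=> w _; apply: sume_ge0 => t _; rewrite lee_fin.
- by apply: emeasurable_sum => t; exact/measurable_EFinP.
- by move=> w _; rewrite lee_fin addr_ge0// mulr_ge0.
- by apply/measurable_EFinP; apply: measurable_funD => //; exact: measurable_funM.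
have := ae_uniform_support (measurable_sphere r) _ unif.
rewrite {1}/sphere_area preimage_set0 setI0 integral_set0 => /(_ erefl).
apply: filterS => w supp _.
rewrite sumEFin lee_fin.
pose u i := grid_cell h (chart r (X i w)); pose v i := grid_cell h (chart r (Y i w)).
apply: (@le_trans _ _ (5 * m%:R ^+ 2 * matchc (@zdist R) u v)).
  apply: le_trans (sum_matchc_patch R K m u v).
  rewrite le_eqVlt; apply/orP; left; apply/eqP; apply: eq_bigr => t _.
  by apply: matchc_ext => i; rewrite ffunE.
rewrite -[X in _ <= X + _]mulrA -mulrDr ler_wpM2l ?mulr_ge0// min_matchingE.
apply: assign_affine => // i j.
apply: (le_trans (zdist_grid_cell _ _ h0)); rewrite lerD2r.
rewrite [leRHS]mulrAC ler_pM2r ?invr_gt0//.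
apply: chart_lipschitz => //; [exact: (supp (inl i))|exact: (supp (inr j))].
Qed.

(** * Choice of scales and conclusion *)

(** The witnesses are [K = n %/ 32], [m.+1] the integer part of [l], and [h = l / m.+1]. From
    [n >= 32 ^ 2] follows [32 * l <= n], so [8 * (K * h + l)] is at most [n / 2 + n / 4]. The factor
    8 combines with [n / 4 <= r] to keep the patches below [r / 2]. *)
Lemma grid_scale (R : realType) (n : nat) : (1024 <= n)%N ->
  let l : R := Num.sqrt n%:R in
  exists m : nat, exists K : nat, exists h : R,
  [/\ 1 <= h <= 2, l = m.+1%:R * h, m.+1%:R <= l, n%:R <= 64 * K%:R :> R &
      8 * ((K + m.+1)%:R * h) <= n%:R].
Proof.
move=> n_large l.
have l2 : l ^+ 2 = n%:R by rewrite sqr_sqrtr.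
have K1 : (n <= 64 * (n %/ 32))%N by lia.
have K2 : (32 * (n %/ 32) <= n)%N by lia.
set K := (n %/ 32)%N in K1 K2.
have {}K1 : n%:R <= 64 * K%:R :> R by rewrite -natrM ler_nat.
have {}K2 : 32 * K%:R <= n%:R :> R by rewrite -natrM ler_nat.
have n1024 : 32 * 32 <= n%:R :> R by rewrite -natrM ler_nat.
have l0 : 0 <= l by exact: sqrtr_ge0.
have l32 : 32 <= l by clear -n1024 l2 l0; nra.
have tl : (0 < Num.truncn l)%N by rewrite truncn_gt0; clear -l32; lra.
have /andP[] := truncn_itv l0.
move: tl; case: (Num.truncn l) => // m _ ml lm.
rewrite -[m.+2]addn1 natrD in lm.
exists m, K, (l / m.+1%:R).
have m1 : 1 <= m.+1%:R :> R by rewrite ler1n.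
have m0 : 0 < m.+1%:R :> R by [].
have lE : l = m.+1%:R * (l / m.+1%:R) by rewrite mulrC divfK// gt_eqF.
have h1 : 1 <= l / m.+1%:R by rewrite ler_pdivlMr// mul1r.
have h2 : l / m.+1%:R <= 2 by rewrite ler_pdivrMr//; clear -lm m1; lra.
split=> //; first by rewrite h1.
rewrite natrD (mulrDl K%:R) -lE.
have Kh : K%:R * (l / m.+1%:R) <= K%:R * 2 by rewrite ler_wpM2l.
have ln : 32 * l <= n%:R by rewrite -l2 expr2 ler_wpM2r.
have aux (x y z w : R) : 0 <= w -> x <= z * 2 -> 32 * y <= w ->
    32 * z <= w -> 8 * (x + y) <= w.
  by lra.
exact: aux (ler0n _ n) Kh ln K2.
Qed.

(** From [m ^ 2 <= n] and [n ^ 2 <= q * K ^ 2] one gets [n * v <= 5 * q * (13 * e + 2 * n ^ 2)].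
    With [h <= 2] this becomes [130 * q * e + 20 * q * n ^ 2], and the error terms add [8 * n ^ 2];
    the constant 200 covers both 130 and 28. *)
Lemma final_bound (R : realType) (n K m h l g v e q : R) :
  1 <= h <= 2 -> 0 < n -> 0 <= e -> 0 < m -> m <= l -> l ^+ 2 = n ->
  n <= 64 * K -> 1 <= q -> q = 64 ^+ 2 -> g <= v + 2 * (m * l) ->
  K ^+ 2 * v <= 5 * m ^+ 2 * (13 / h) * e + 5 * m ^+ 2 * (2 * n ^+ 2) ->
  n^-1 * (h * g + 2 * h * n) <= 200 * q + 200 * q / n ^+ 2 * e.
Proof.
move=> /andP[h1 h2] n0 e0 m0 ml l2 nK q1 qE gv vE.
have h0 : 0 < h by lra.
have m2n : m ^+ 2 <= n by rewrite -l2 ler_pXn2r// nnegrE; lra.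
have mln : m * l <= n by rewrite -l2 expr2 ler_wpM2r//; lra.
have B0 : 0 <= 13 * e + 2 * n ^+ 2 by have := sqr_ge0 n; lra.
have vB : K ^+ 2 * v <= 5 * n * (13 * e + 2 * n ^+ 2).
  have he : 13 / h * e <= 13 * e.
    by rewrite ler_wpM2r// ler_pdivrMr// ler_peMr.
  have he0 : 0 <= 13 / h * e by rewrite mulr_ge0// divr_ge0// ltW.
  apply: (le_trans vE); rewrite -[5 * _ * _ * e]mulrA -mulrDr.
  apply: ler_pM; [by rewrite mulr_ge0// sqr_ge0| |by rewrite ler_pM2l|by rewrite lerD2r].
  by rewrite addr_ge0// mulr_ge0// sqr_ge0.
have {}vB : n * v <= 5 * q * (13 * e + 2 * n ^+ 2).
  (* Multiplying [n ^ 2 <= q * K ^ 2] by [v] requires [0 <= v]; otherwise the bound is trivial. *)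
  have [v0|/ltW v0] := leP v 0.
    apply: (@le_trans _ _ 0); first by rewrite mulr_ge0_le0// ltW.
    by rewrite !mulr_ge0//; lra.
  have n2 : n ^+ 2 <= q * K ^+ 2.
    by rewrite qE -exprMn ler_pXn2r// nnegrE; lra.
  rewrite -(ler_pM2l n0) mulrA -expr2 (le_trans (ler_wpM2r v0 n2))//.
  rewrite -[leLHS]mulrA (le_trans (ler_wpM2l _ vB))//; first by lra.
  by rewrite le_eqVlt; apply/orP; left; apply/eqP; ring.
have hv : n * (h * v) <= 2 * (5 * q * (13 * e + 2 * n ^+ 2)).
  have [v0|/ltW v0] := leP v 0.
    apply: (@le_trans _ _ 0).
      exact: mulr_ge0_le0 (ltW n0) (mulr_ge0_le0 (ltW h0) v0).
    by rewrite !mulr_ge0//; lra.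
  rewrite mulrCA (@le_trans _ _ (2 * (n * v)))//; last by rewrite ler_wpM2l.
  by rewrite ler_wpM2r// mulr_ge0// ltW.
rewrite ler_pdivrMl// -(ler_pM2l n0).
have -> : n * (n * (200 * q + 200 * q / n ^+ 2 * e)) = 200 * q * n ^+ 2 + 200 * q * e.
  by field; rewrite gt_eqF.
have hg : h * g <= h * v + 4 * n.
  apply: (@le_trans _ _ (h * (v + 2 * (m * l)))); first by rewrite ler_pM2l.
  rewrite mulrDr lerD2l; apply: (@le_trans _ _ (2 * (2 * n))); last lra.
  by apply: ler_pM => //; [lra|rewrite !mulr_ge0//; lra|rewrite ler_pM2l].
have hn : 2 * h * n <= 4 * n by rewrite ler_pM2r//; lra.
apply: (@le_trans _ _ (n * (h * v + 8 * n))).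
  by rewrite ler_pM2l//; lra.
rewrite mulrDr.
have qn : n ^+ 2 <= q * n ^+ 2 by rewrite ler_peMl// sqr_ge0.
have qe : 0 <= q * e by rewrite mulr_ge0//; lra.
have -> : n * (8 * n) = 8 * n ^+ 2 by ring.
move: hv; rewrite (_ : 2 * (5 * q * (13 * e + 2 * n ^+ 2)) =
  130 * (q * e) + 20 * (q * n ^+ 2)); last by ring.
move: (sqr_ge0 n) qn qe; rewrite -!mulrA.
move: (q * e) (q * n ^+ 2) (n ^+ 2) (n * (h * v)) => a b c d; lra.
Qed.

Lemma planar_matching_mean_le (R : realType) (m n : nat) :
  pexp (@umass R ('I_m.+1 * 'I_m.+1)%type) (fun a : {ffun 'I_n -> _} =>
    pexp (@umass R _) (fun b : {ffun 'I_n -> _} => matchc (@qdist R m.+1) a b)) <=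
  2 * m.+1%:R * n%:R.
Proof.
have Q0 : (0 < #|{: 'I_m.+1 * 'I_m.+1}|)%N by rewrite card_prod card_ord.
have u0 (q : 'I_m.+1 * 'I_m.+1) : 0 <= umass R q by rewrite invr_ge0.
have u1 := sum_umass R Q0.
rewrite -[leRHS](@pexp_cst R 'I_n ('I_m.+1 * 'I_m.+1)%type (@umass R _))//.
apply: pexp_le => // a.
rewrite -[leRHS](@pexp_cst R 'I_n ('I_m.+1 * 'I_m.+1)%type (@umass R _))//.
apply: pexp_le => // b.
apply: (le_trans (assign_le _ 1%g)).
rewrite mulr_natr -[n in leRHS]card_ord -sumr_const; apply: ler_sum => i _.
by have /andP[] := qdist_le R (a i) (b ((1%g : 'S_n) i)).
Qed.

Theorem proposition8 (R : realType) :
  exists C : R, forall n : nat, (2 <= n)%N ->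
  let N := (n ^ 2)%N in
  let r : R := Num.sqrt (N%:R / (4 * pi)) in
  let l : R := Num.sqrt n%:R in
  forall (d d' : measure_display)
    (T : measurableType d) (P : probability T R)
    (T' : measurableType d') (P' : probability T' R)
    (X Y : 'I_N -> {RV P >-> (R * R * R)%type})
    (A B : 'I_n -> {RV P' >-> (R * R)%type}),
  iid_uniform (sphere_area r) (sphere r) (join_families X Y) ->
  iid_uniform (@lebesgue2 R) (square l) (join_families A B) ->
  ((n%:R^-1)%:E * 'E_P'[fun w => min_matching (@norm2 R) (A ^~ w) (B ^~ w)]
   <= C%:E + (C / N%:R)%:E
        * 'E_P[fun w => min_matching (@norm3 R) (X ^~ w) (Y ^~ w)])%E.
Proof.
have [q q1 qE] : exists2 q : R, 1 <= q & q = 64 ^+ 2.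
  by exists (64 ^+ 2) => //; rewrite exprn_ege1// ler1n.
exists (200 * q) => n n2 N r l d d' T P T' P' X Y A B iidXY iidAB.
have n0 : 0 < n%:R :> R by rewrite ltr0n ltnW.
have nN : N%:R = n%:R ^+ 2 :> R by rewrite natrX.
have N0 : 0 < N%:R :> R by rewrite nN exprn_gt0.
have l0 : 0 < l by rewrite sqrtr_gt0.
have l2 : l ^+ 2 = n%:R by rewrite sqr_sqrtr// ltW.
have EX0 : (0 <= 'E_P[fun w => min_matching (@norm3 R) (X ^~ w) (Y ^~ w)])%E.
  apply: expectation_ge0 => w; rewrite min_matchingE.
  by apply: assign_ge0 => i j; exact: sqrtr_ge0.
have q0 : 0 < 200 * q by rewrite mulr_gt0// (lt_le_trans _ q1).
have C0 : 0 < 200 * q / N%:R by rewrite divr_gt0.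
have ler_EAB (c c' : R) :
    ('E_P'[fun w => min_matching (@norm2 R) (A ^~ w) (B ^~ w)] <= c%:E)%E ->
    n%:R^-1 * c <= c' ->
    ((n%:R^-1)%:E * 'E_P'[fun w => min_matching (@norm2 R) (A ^~ w) (B ^~ w)] <= c'%:E)%E.
  move=> Ec cc'; apply: (@le_trans _ _ ((n%:R^-1)%:E * c%:E)%E).
    by rewrite lee_wpmul2l// lee_fin invr_ge0 ltW.
  by rewrite -EFinM lee_fin.
(* For small [n] a single cell of side [l] suffices: the normalized cost is at most
   [4 * l <= 128]. *)
have [n_small|n_large] := ltnP n 1024.
  have lE : l = 1%:R * l by rewrite mul1r.
  have RHS_ge : ((200 * q)%:E <= (200 * q)%:E + (200 * q / N%:R)%:E *
      'E_P[fun w => min_matching (@norm3 R) (X ^~ w) (Y ^~ w)])%E.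
    by rewrite leeDl// mule_ge0// lee_fin ltW.
  apply: le_trans RHS_ge; apply: (ler_EAB _ _ (planar_expectation_le l0 lE iidAB)).
  have := @planar_matching_mean_le R 0 n.
  have : n%:R <= 32 * 32 :> R by rewrite -natrM ler_nat ltnW.
  rewrite ler_pdivrMl// -l2.
  move: (pexp _ _) => G; move: l0 q1; clear; move: l => l.
  move=> l0 q1 l32 g.
  have {}l32 : l <= 32 by nra.
  have : l * G <= l * (2 * l ^+ 2) by rewrite ler_wpM2l ?(ltW l0)// -[2]mulr1.
  have : l * l ^+ 2 <= 32 * l ^+ 2 by rewrite ler_wpM2r ?sqr_ge0.
  have : l ^+ 2 * 200 <= l ^+ 2 * (200 * q).
    by rewrite ler_wpM2l ?sqr_ge0// ler_peMr.
  move: (l * G) (l ^+ 2) (sqr_ge0 l) => a b *; nra.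
have [m [K [h [/andP[h1 h2] lE ml nK KmL]]]] := grid_scale R n_large.
rewrite -/l in lE ml.
have h0 : 0 < h := lt_le_trans ltr01 h1.
have pi0 : 0 < pi :> R := pi_gt0 R.
(* Since [4 * pi * r ^ 2 = n ^ 2], this gives [n / 4 <= r]. *)
have pi4 : pi <= 4 :> R.
  by rewrite (_ : 4 = 2 * 2) -?ler_pdivrMr ?ltW ?pihalf_lt2//; ring.
have r2 : 4 * pi * r ^+ 2 = N%:R.
  rewrite sqr_sqrtr; last by rewrite divr_ge0// mulr_ge0// ltW.
  by move: (@pi R) pi0 => w w0; field; rewrite gt_eqF.
have r0 : 0 < r by rewrite sqrtr_gt0 divr_gt0// mulr_gt0.
have rn : n%:R / 4 <= r.
  rewrite -(@ler_pXn2r _ 2)// ?nnegrE ?divr_ge0 ?(ltW r0)//.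
  move: r2; rewrite nN; move: (@pi R) pi0 pi4 (r ^+ 2) (sqr_ge0 r) (n%:R : R).
  by clear => w w0 w4 x x0 y; nra.
have {}KmL : (K + m.+1)%:R * h <= r / 2.
  move: KmL rn; move: (_%:R * h) (n%:R : R).
  by clear => x y; lra.
(* The patch has area [l ^ 2 = n] out of [N = n ^ 2], so the mean number of points in it is
   [N / n = n]. *)
have pE : n%:R^-1 = (m.+1%:R * h) ^+ 2 / (4 * pi * r ^+ 2).
  by rewrite -lE l2 r2 nN expr2 invfM mulrA divff ?mul1r// gt_eqF.
have := sphere_expectation_ge h0 r0 (ltn0Sn m) KmL iidXY pE.
have := @pexp_matchc_le R ('I_m.+1 * 'I_m.+1)%type (@qdist R m.+1) m.+1%:R
  n%:R^-1 l n N.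
set v := pexp (omass _) _; set g := pexp _ _ => gv vE.
have {}gv : g <= v + 2 * (m.+1%:R * l).
  apply: gv => //.
  - by rewrite card_prod card_ord.
  - by rewrite /N expnS expn1 leq_pmulr// ltnW.
  - by rewrite invr_ge0 ltW//= invf_le1// ler1n ltnW.
  - by rewrite nN expr2 mulfK// gt_eqF.
  - exact: qdistxx.
  - by move=> p p'; exact: zdist_sym.
  - by move=> p p'; exact: qdist_le.
  - by move=> p p' p''; exact: zdist_tri.
move: EX0 vE.
(* If the expectation on the sphere is infinite, so is the right-hand side; the value minus infinity
   is excluded by [EX0]. *)
case: ('E_P[_])%E => [e e0 vE|_ _|//]; last first.
  by rewrite gt0_muley ?lte_fin// addey// leey.
rewrite -!EFinM -EFinD lee_fin nN in vE; rewrite lee_fin in e0.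
rewrite -EFinM -EFinD.
apply: (ler_EAB _ _ (planar_expectation_le h0 lE iidAB)); rewrite -/g nN.
by apply: (final_bound _ n0 e0 _ ml l2 nK q1 qE gv vE); rewrite ?h1.
Qed.
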